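(* Let $S$ be a finite set, $\mathbb{A}=\{(x_0,x_1,x_2,\dots): x_i\in S\}$, and $\sigma$ the left shift on $\mathbb{A}$. Fix $\theta\in(0,1)$ and equip $\mathbb{A}$ with the metric $d(x,y)=\theta^{\inf\{n\ge 0: x_n\neq y_n\}}$. Let $\phi_p:\mathbb{A}\to\mathbb{R}$ and a number $\|\phi_p\|\ge1$ satisfy $\|\phi_p\|_\infty\le\|\phi_p\|$, $|\phi_p(x)-\phi_p(y)|\le\|\phi_p\|d(x,y)$, and $\sum_{b\in S}e^{\phi_p(bx)}=1$ for all $x$. Let $\mu_{\phi_p}$ be the equilibrium state of $\phi_p$ (a $\sigma$-invariant probability measure) and $\mathbb{E}$ the expectation with respect to it. Let $\phi:\mathbb{A}\to\mathbb{R}$ and a number $\|\phi\|\ge1$ satisfy $\|\phi\|_\infty\le\|\phi\|$ and $|\phi(x)-\phi(y)|\le\|\phi\|d(x,y)$, and assume $\mathbb{E}\phi=0$. Let $a=1-\exp(-\|\phi_p\|(1-\theta)^{-1})$, $\epsilon\in(0,\min\{1-a,1-\theta\})$, $U:=\frac{\log(1-\epsilon)}{\log[\theta\epsilon(1-\epsilon-\theta)]-\log(2\|\phi_p\|)}$, and $z_0\in\big(1,\min\{(\frac{a+\epsilon/2}{a})^{U},\frac{\theta+\epsilon}{\theta},\frac{1-\epsilon}{\theta},e^2\}\big)$. Then for every $u>0$ and every positive integer $n$, \begin{align*}&\mu_{\phi_p}\Big(\Big|\frac{\sum_{i\le n-1}\phi\circ\sigma^i}{n}\Big|\ge u\Big)\\&\le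 2\exp\Big(\frac{u(1-z_0^{-0.5})(1-a-\epsilon)(\ln\sqrt{z_0})}{36\|\phi\|z_0^{0.5}}\Big)\exp\Big(-\frac{u^2n(1-z_0^{-0.5})^2(1-a-\epsilon)^2(\ln\sqrt{z_0})^2}{72\|\phi\|^2}\Big),\end{align*} where the sum runs over $0\le i\le n-1$.
   Context: For $b\in S$ and $x=(x_0,x_1,\dots)$, $bx=(b,x_0,x_1,\dots)$. The left shift is $\sigma(x_0,x_1,\dots)=(x_1,x_2,\dots)$. The numbers $\|\phi_p\|,\|\phi\|\ge1$ bound both the sup norm and the Lipschitz constant (with respect to $d$) of the respective functions. *)

(* Defs.v *)
From HB Require Import structures.
From mathcomp Require Import all_boot all_order all_algebra.
From mathcomp Require Import all_classical all_reals all_analysis.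

Set Implicit Arguments.
Unset Strict Implicit.
Unset Printing Implicit Defensive.

Import Order.TTheory GRing.Theory Num.Theory.
Import numFieldNormedType.Exports.
Local Open Scope classical_set_scope.
Local Open Scope ring_scope.

Section ShiftSpace.
Variables (S : finType) (s0 : S).

(* The full one-sided shift space  A = S^N  (s0 is only used to make the
   carrier a pointedType, as required by MathComp-Analysis). *)
Definition seqspace : Type := let _ := s0 in nat -> S.
HB.instance Definition _ := gen_eqMixin seqspace.
HB.instance Definition _ := gen_choiceMixin seqspace.
HB.instance Definition _ := isPointed.Build seqspace (fun _ => s0).

Definition coord_sets : set (set seqspace) :=
  [set B | exists (i : nat) (s : S), B = [set x | x i = s]].

Definition shiftA := g_sigma_algebraType coord_sets.

End ShiftSpace.

Arguments seqspace {S} s0.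
Arguments shiftA {S} s0.

Definition left_shift {S : Type} (x : nat -> S) : nat -> S := fun n => x n.+1.

Definition scons {S : Type} (b : S) (x : nat -> S) : nat -> S :=
  fun n => if n is k.+1 then x k else b.

(* d(x,y) = theta^(inf{n | x_n <> y_n}), with theta^(+oo) = 0. *)
Definition dist {R : realType} {S : finType} (theta : R) (x y : nat -> S) : R :=
  match pselect (exists n, x n != y n) with
  | left h => theta ^+ (ex_minn h)
  | right _ => 0
  end.

Definition bounded_lip {R : realType} {S : finType} (theta K : R)
  (f : (nat -> S) -> R) : Prop :=
  (forall x, `|f x| <= K) /\ (forall x y, `|f x - f y| <= K * dist theta x y).

Section Entropy.
Variables (R : realType) (S : finType) (s0 : S).
Local Notation T := (shiftA s0).

Definition shift_invariant (mu : probability T R) : Prop :=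
  forall B : set T, measurable B -> mu (@left_shift S @^-1` B) = mu B.

Definition is_fin_partition (k : nat) (P : 'I_k -> set T) : Prop :=
  (forall i, measurable (P i)) /\
  (forall i j, i != j -> P i `&` P j = set0) /\
  (forall x : T, exists i, P i x).

(* H_mu( P v sigma^-1 P v ... v sigma^-(n-1) P ) *)
Definition part_entropy_n (mu : probability T R) (k : nat) (P : 'I_k -> set T)
  (n : nat) : R :=
  \sum_(w : {ffun 'I_n -> 'I_k})
     (let p := fine (mu [set x : T | forall i : 'I_n, P (w i) (iter i (@left_shift S) x)])
      in - (p * ln p)).

Definition part_entropy (mu : probability T R) (k : nat) (P : 'I_k -> set T) : R :=
  limn (fun n : nat => part_entropy_n mu P n / n%:R).

Definition ks_entropy (mu : probability T R) : \bar R :=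
  ereal_sup [set e | exists (k : nat) (P : 'I_k -> set T),
                       is_fin_partition P /\ e = (part_entropy mu P)%:E].

Definition is_equilibrium_state (psi : (nat -> S) -> R) (mu : probability T R) : Prop :=
  shift_invariant mu /\
  forall nu : probability T R, shift_invariant nu ->
    (ks_entropy nu + \int[nu]_x (psi x)%:E <= ks_entropy mu + \int[mu]_x (psi x)%:E)%E.

End Entropy.

Definition a_const {R : realType} (theta Np : R) : R := 1 - expR (- (Np / (1 - theta))).

Definition U_const {R : realType} (theta Np eps : R) : R :=
  ln (1 - eps) / (ln (theta * eps * (1 - eps - theta)) - ln (2 * Np)).

(* Main.v *)
Require Import Defs.
From HB Require Import structures.
From mathcomp Require Import all_boot all_order all_algebra.
From mathcomp Require Import all_classical all_reals all_analysis.
From mathcomp Require Import measurable_realfun.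
From mathcomp Require Import ring lra.
Import Order.TTheory GRing.Theory Num.Theory.
Import numFieldNormedType.Exports.
Local Open Scope classical_set_scope.
Local Open Scope ring_scope.

Set Implicit Arguments.
Unset Strict Implicit.
Unset Printing Implicit Defensive.

(* With [L f x = \sum_b expR (phip (b x)) * f (b x)], the key point is that an
   equilibrium state [mu] satisfies [\int L f = \int f] for Lipschitz [f].
   Gibbs' inequality bounds the entropy of every partition, hence
   [ks_entropy mu], by [- \int g dmu] for every normalized Lipschitz potential
   [g].  A Gibbs measure [nu], with cylinder masses given by limits of iterates
   of [L], has [ks_entropy nu >= - \int phip dnu], so the free energy of [mu] for
   [phip] is nonnegative.  Thus [g = phip] maximizes [\int g dmu] among
   normalized potentials, and the first variation along
   [phip + t f - (ln (L expR(t f))) o sigma] is [\int f - \int L f = 0].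

   Concentration is then an exponential-moment bound.  Coupling two histories
   gives [|\sum_(i <= k) L^i phi (x) - \sum_(i <= k) L^i phi (y)| <= D] with
   [D = N exp(Np theta / (1 - theta)) / (1 - theta)], and peeling off one
   coordinate at a time costs a factor [exp (2 (l D)^2)], so that
   [\int expR (l S_n phi) <= exp (l D + 2 n (l D)^2)] for small [l >= 0].
   The constants of the statement leave room: of the upper bounds on [z0],
   only [z0 <= 3 / 2] (which follows from [U <= 1]) and [theta z0 <= 1] matter. *)

(** * Lipschitz functions and the transfer operator *)

(** The hypothesis on [mu] is purely variational and says nothing directly about conditional
    probabilities, while the concentration argument uses only [\int L f = \int f] and the zero mean
    of [phi]. Two features of the definitions shape the bridge between them. The supremum in
    [ks_entropy] runs over all measurable partitions, so Gibbs' inequality has to work with cells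
    guessed from finitely many coordinates. And [mu] is only compared with other invariant measures,
    so a competitor of nonnegative free energy must actually be built.

    Origin of [D]: in the coupling, a run of matches started at distance 1 lasts forever with
    probability at least [exp (- Np theta / (1 - theta))] and contributes total distance at most
    [1 / (1 - theta)]. The number of runs is thus dominated by a geometric variable of mean
    [exp (Np theta / (1 - theta))]. The factor [1 - a = exp (- Np / (1 - theta))] in the exponents
    of the statement compensates this exponential, so [D] times that factor is bounded independently
    of [Np]. *)

Lemma expRN_le1 {R : realType} (z : R) : 0 <= z -> expR (- z) <= 1.
Proof. by move=> z0; rewrite -expR0 ler_expR oppr_le0. Qed.

Section Distance.
Context {R : realType} {S : finType} {theta : R}.
Hypothesis (htheta : 0 < theta < 1).
Implicit Types (x y : nat -> S) (b : S).

Lemma theta_ge0 : 0 <= theta. Proof. by case/andP: htheta => /ltW. Qed.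
Lemma theta_le1 : theta <= 1. Proof. by case/andP: htheta => _ /ltW. Qed.

Variant dist_spec x y : R -> Prop :=
| DistEq of x = y : dist_spec x y 0
| DistNeq n of x n != y n & (forall i, (i < n)%N -> x i = y i) :
    dist_spec x y (theta ^+ n).

Lemma distP x y : dist_spec x y (dist theta x y).
Proof.
rewrite /dist; case: pselect => [h|h].
  case: ex_minnP => n hn hmin; constructor => // i; rewrite ltnNge => lin.
  by apply/eqP; apply: contraNT lin; exact: hmin.
constructor; apply/funext => n; apply/eqP/negPn/negP => hn; apply: h.
by exists n.
Qed.

Lemma dist_ge0 x y : 0 <= dist theta x y.
Proof. by case: distP => // n _ _; rewrite exprn_ge0 ?theta_ge0. Qed.

Lemma dist_le_expn k x y :
  (forall i, (i < k)%N -> x i = y i) -> dist theta x y <= theta ^+ k.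
Proof.
move=> xy; case: distP => [_|n xyn _]; first by rewrite exprn_ge0 ?theta_ge0.
rewrite ler_wiXn2l ?theta_ge0 ?theta_le1 // leqNgt; apply/negP => nk.
by rewrite xy ?eqxx in xyn.
Qed.

Lemma dist_le1 x y : dist theta x y <= 1.
Proof. by apply: (@dist_le_expn 0). Qed.

Lemma dist_scons b x y :
  dist theta (scons b x) (scons b y) = theta * dist theta x y.
Proof.
case: (distP x y) => [->|n xyn xy].
  by rewrite mulr0; case: distP => [//|n /eqP[]].
case: distP => [e|m].
  by case/eqP: xyn; exact: (congr1 (@^~ n.+1) e).
move=> xym xy'; rewrite -exprS; congr (_ ^+ _).
case: m => [|m] in xym xy' *.
  by exfalso; case/eqP: xym.
apply/eqP; rewrite eqSS eqn_leq.
apply/andP; split; rewrite leqNgt; apply/negP => h.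
  by case/eqP: xyn; exact: (xy' n.+1).
by case/eqP: xym; exact: xy.
Qed.

Lemma dist_left_shift x y :
  dist theta (left_shift x) (left_shift y) <= theta^-1 * dist theta x y.
Proof.
rewrite ler_pdivlMl; last by case/andP: htheta.
case: (distP x y) => [->|[|n] xyn xy].
- by case: distP => [_|n /eqP[]]; rewrite ?mulr0.
- by rewrite expr0 mulr_ile1 ?theta_ge0 ?theta_le1 ?dist_ge0 ?dist_le1.
- rewrite exprS ler_wpM2l ?theta_ge0 //; apply: dist_le_expn => i hi.
  exact: xy.
Qed.

(** The constant is hidden because entropy and stationarity only need a class closed under the
    operations below; the contraction and concentration estimates carry explicit constants
    instead. *)
Definition theta_lip (f : (nat -> S) -> R) :=
  exists2 K, 0 <= K & forall x y, `|f x - f y| <= K * dist theta x y.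

Lemma bounded_lip_lipschitz K f : 0 <= K -> bounded_lip theta K f -> theta_lip f.
Proof. by move=> K0 [_ ?]; exists K. Qed.

Lemma lipschitz_bounded f : theta_lip f -> exists2 M, 0 < M & forall x, `|f x| <= M.
Proof.
(* Over an empty alphabet there is no sequence at all, so any bound holds. *)
move=> [K K0 fK]; have [s|S0] := pickP S; last first.
  by exists 1 => // x; have := S0 (x 0).
exists (`|f (fun=> s)| + K + 1); first by rewrite ltr_pwDr ?addr_ge0.
move=> x; rewrite -[f x](subrK (f (fun=> s))).
rewrite (le_trans (ler_normD _ _)) // addrC -addrA lerD2l.
rewrite ler_wpDr // (le_trans (fK _ _)) // ler_piMr ?dist_le1 //.
Qed.

Lemma lipschitz_cst c : theta_lip (fun=> c).
Proof. by exists 0 => // x y; rewrite subrr normr0 mul0r. Qed.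

Lemma lipschitzD f g : theta_lip f -> theta_lip g -> theta_lip (fun x => f x + g x).
Proof.
move=> [K K0 fK] [K' K'0 gK]; exists (K + K'); first exact: addr_ge0.
move=> x y; rewrite opprD addrACA mulrDl (le_trans (ler_normD _ _)) //.
exact: lerD.
Qed.

Lemma lipschitzM f g : theta_lip f -> theta_lip g -> theta_lip (fun x => f x * g x).
Proof.
move=> lf lg; have [M M0 fM] := lipschitz_bounded lf.
have [M' M'0 gM] := lipschitz_bounded lg.
case: lf lg => K K0 fK [K' K'0 gK].
exists (M' * K + M * K'); first by rewrite addr_ge0 // mulr_ge0 // ltW.
move=> x y.
have -> : f x * g x - f y * g y = g x * (f x - f y) + f y * (g x - g y) by ring.
rewrite (le_trans (ler_normD _ _)) // mulrDl !normrM -!mulrA.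
by apply: lerD; apply: ler_pM.
Qed.

Lemma lipschitzZ c f : theta_lip f -> theta_lip (fun x => c * f x).
Proof. exact/lipschitzM/lipschitz_cst. Qed.

Lemma lipschitzB f g : theta_lip f -> theta_lip g -> theta_lip (fun x => f x - g x).
Proof.
move=> lf /(lipschitzZ (-1)) lg.
by under eq_fun do rewrite -mulN1r; exact: lipschitzD.
Qed.

Lemma lipschitz_sum (I : Type) (r : seq I) (f : I -> (nat -> S) -> R) :
  (forall i, theta_lip (f i)) -> theta_lip (fun x => \sum_(i <- r) f i x).
Proof.
move=> lf; elim: r => [|i r IH].
  by under eq_fun do rewrite big_nil; exact: lipschitz_cst.
by under eq_fun do rewrite big_cons; exact: lipschitzD.
Qed.

Lemma expR_lip (M : R) u v : u <= M -> v <= M -> `|expR u - expR v| <= expR M * `|u - v|.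
Proof.
wlog uv : u v / v <= u => [H|uM vM].
  case/orP: (le_total v u) => h uM vM; first exact: H.
  by rewrite distrC (distrC u); exact: H.
rewrite !ger0_norm ?subr_ge0 ?ler_expR //.
have -> : expR u - expR v = expR u * (1 - expR (v - u)).
  by rewrite mulrBr mulr1 -expRD [u + _]addrC subrK.
apply: ler_pM; rewrite ?expR_ge0 ?ler_expR // ?subr_ge0.
  by rewrite -expR0 ler_expR subr_le0.
by have := expR_ge1Dx (v - u); lra.
Qed.

Lemma lipschitz_expR f : theta_lip f -> theta_lip (fun x => expR (f x)).
Proof.
move=> lf; have [M M0 fM] := lipschitz_bounded lf.
case: lf => K K0 fK; exists (expR M * K); first by rewrite mulr_ge0 ?expR_ge0.
move=> x y; rewrite -mulrA.
apply: le_trans (ler_wpM2l (expR_ge0 _) (fK x y)).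
by apply: expR_lip; apply: le_trans (ler_norm _) _.
Qed.

Lemma lipschitz_left_shift f : theta_lip f -> theta_lip (f \o left_shift).
Proof.
case: htheta => /andP [t0 _] [K K0 fK].
exists (K * theta^-1); first by rewrite mulr_ge0 ?invr_ge0 ?theta_ge0.
move=> x y; rewrite -mulrA; apply: (le_trans (fK _ _)).
by rewrite ler_wpM2l // dist_left_shift.
Qed.

Lemma lipschitz_scons b f : theta_lip f -> theta_lip (fun x => f (scons b x)).
Proof.
move=> [K K0 fK]; exists K => // x y; rewrite (le_trans (fK _ _)) //.
rewrite dist_scons mulrCA ler_piMl ?theta_le1 // mulr_ge0 ?dist_ge0 //.
Qed.

End Distance.
Arguments theta_lip {R S} theta f.

(** Ruelle's transfer operator. When [\sum_b expR (psi (scons b x)) = 1] it averages over the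
    preimages of [x] under the shift, that is, it is the Markov operator of the chain that prepends
    random symbols. *)
Definition transfer {R : realType} {S : finType} (psi f : (nat -> S) -> R)
    (x : nat -> S) : R :=
  \sum_(b : S) expR (psi (scons b x)) * f (scons b x).

Section Transfer.
Context {R : realType} {S : finType} {theta : R}.
Hypothesis (htheta : 0 < theta < 1).
Context {psi : (nat -> S) -> R}.
Hypothesis (psi1 : forall x, \sum_(b : S) expR (psi (scons b x)) = 1).
Implicit Types (f g : (nat -> S) -> R) (x y : nat -> S).

Local Notation L := (transfer psi).

Lemma ler_transfer f g : (forall x, f x <= g x) -> forall x, L f x <= L g x.
Proof. by move=> fg x; apply: ler_sum => b _; rewrite ler_wpM2l ?expR_ge0. Qed.

Lemma transferD f g x : L (fun y => f y + g y) x = L f x + L g x.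
Proof. by rewrite -big_split; apply: eq_bigr => b _; rewrite mulrDr. Qed.

Lemma transferZ c f x : L (fun y => c * f y) x = c * L f x.
Proof. by rewrite /transfer mulr_sumr; apply: eq_bigr => b _; rewrite mulrCA. Qed.

Lemma transfer_cst c x : L (fun=> c) x = c.
Proof. by rewrite /transfer -mulr_suml psi1 mul1r. Qed.

(** All preimages of [x] have the same shift [x], so [g] leaves the average. This is what allows one
    coordinate at a time to be peeled off in [mgf_step]. *)
Lemma transferM_shift f g x : L (fun y => f y * g (left_shift y)) x = L f x * g x.
Proof. by rewrite /transfer mulr_suml; apply: eq_bigr => b _; rewrite mulrA. Qed.

Lemma transfer_sum (I : Type) (r : seq I) (F : I -> (nat -> S) -> R) x :
  L (fun y => \sum_(i <- r) F i y) x = \sum_(i <- r) L (F i) x.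
Proof.
rewrite /transfer exchange_big /=; apply: eq_bigr => b _.
by rewrite mulr_sumr.
Qed.

Lemma transfer_near f r B :
  (forall x, `|f x - r| <= B) -> forall x, `|L f x - r| <= B.
Proof.
move=> fB x; rewrite ler_norml; apply/andP; split.
  rewrite lerBrDl -[r - B](transfer_cst _ x); apply: ler_transfer => y.
  by have := fB y; rewrite ler_norml => /andP[+ _]; lra.
rewrite lerBlDl -[r + B](transfer_cst _ x); apply: ler_transfer => y.
by have := fB y; rewrite ler_norml => /andP[_]; lra.
Qed.

Lemma lipschitz_transfer f : theta_lip theta psi -> theta_lip theta f -> theta_lip theta (L f).
Proof.
move=> lpsi lf; apply: lipschitz_sum => b.
by apply: lipschitzM => //; last exact: lipschitz_scons;
  apply: lipschitz_expR => //; exact: lipschitz_scons.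
Qed.

(* The two averages are coupled by matching a mass [p] of equal symbols. *)
Lemma transfer_coupling f x y (p w w' : R) : 0 <= p <= 1 ->
  (forall b, p * expR (psi (scons b x)) <= expR (psi (scons b y))) ->
  (forall b, f (scons b x) - f (scons b y) <= w) ->
  (forall x' y', f x' - f y' <= w') ->
  L f x - L f y <= p * w + (1 - p) * w'.
Proof.
move=> /andP[p0 p1] pxy fw fw'.
set P := fun b => expR (psi (scons b x)); set Q := fun b => expR (psi (scons b y)).
(* The joint law puts mass [p * P b] on the pair [(b, b)] and, in addition,
   [P b * (Q b' - p * P b')] on [(b, b')]. Its marginals are [P] and [Q], and the second part has
   total mass [1 - p]. *)
have -> : L f x - L f y = p * (\sum_b P b * (f (scons b x) - f (scons b y)))
   + \sum_b \sum_b' P b * (Q b' - p * P b') * (f (scons b x) - f (scons b' y)).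
  have -> : \sum_b \sum_b' P b * (Q b' - p * P b') * (f (scons b x) - f (scons b' y))
     = \sum_b (1 - p) * (P b * f (scons b x))
       - \sum_b (P b * \sum_b' (Q b' - p * P b') * f (scons b' y)).
    rewrite -sumrB; apply: eq_bigr => b _.
    have -> : 1 - p = \sum_b' (Q b' - p * P b').
      by rewrite sumrB -mulr_sumr psi1 psi1 mulr1.
    rewrite mulr_suml mulr_sumr -sumrB; apply: eq_bigr => b' _.
    by ring.
  rewrite -mulr_suml psi1 mul1r -mulr_sumr.
  have -> : \sum_b' (Q b' - p * P b') * f (scons b' y)
     = L f y - p * (\sum_b P b * f (scons b y)).
    by rewrite mulr_sumr -sumrB; apply: eq_bigr => b _; rewrite /Q; ring.
  have -> : \sum_b P b * (f (scons b x) - f (scons b y))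
     = L f x - \sum_b P b * f (scons b y).
    by rewrite -sumrB; apply: eq_bigr => b _; rewrite /P; ring.
  rewrite -/(L f x); ring.
apply: lerD.
  apply: ler_wpM2l => //; rewrite -[leRHS]mul1r -(psi1 x) mulr_suml.
  by apply: ler_sum => b _; rewrite ler_wpM2l ?expR_ge0.
have -> : (1 - p) * w' = \sum_b P b * ((1 - p) * w').
  by rewrite -mulr_suml psi1 mul1r.
apply: ler_sum => b _; have -> : 1 - p = \sum_b' (Q b' - p * P b').
  by rewrite sumrB -mulr_sumr psi1 psi1 mulr1.
rewrite mulr_suml mulr_sumr; apply: ler_sum => b' _.
by rewrite mulrA ler_wpM2l // mulr_ge0 ?expR_ge0 // subr_ge0; exact: pxy.
Qed.

End Transfer.

(** * Coupling estimates for the transfer operator *)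

Section Contraction.
Context {R : realType} {S : finType} {theta : R}.
Hypothesis (htheta : 0 < theta < 1).
Context {psi : (nat -> S) -> R} {K : R}.
Hypothesis (psi1 : forall x, \sum_(b : S) expR (psi (scons b x)) = 1).
Hypothesis (K0 : 0 <= K).
Hypothesis (psiK : forall x y, `|psi x - psi y| <= K * dist theta x y).
Implicit Types (f g : (nat -> S) -> R) (x y : nat -> S).

Local Notation L := (transfer psi).
Local Notation d := (dist theta).

Definition mixing_bound : R := expR (K * theta / (1 - theta)) / (1 - theta).

(* Expected total discrepancy of the coupled chain started at distance [r]:
   [r / (1 - theta)] bounds a run of matches, and with probability
   [1 - exp (- K theta r / (1 - theta))] the run ends and the chain restarts at
   distance 1. *)
Definition mixing_potential (r : R) : R :=
  r / (1 - theta) + (1 - expR (- (K * theta * r / (1 - theta)))) * mixing_bound.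

Local Notation B := mixing_bound.
Local Notation W := mixing_potential.

Let t0 : 0 < theta. Proof. by case/andP: htheta. Qed.
Let t1 : 0 < 1 - theta. Proof. by case/andP: htheta => _; rewrite subr_gt0. Qed.

Lemma mixing_bound_gt0 : 0 < B.
Proof. by rewrite divr_gt0 ?expR_gt0. Qed.

(** Consistency at a restart: the equation [B = 1 / (1 - theta) + (1 - exp (- K theta / (1 -
    theta))) B] is what determines [mixing_bound]. *)
Lemma mixing_potential1 : W 1 = B.
Proof.
rewrite /W /B (mulr1 (K * theta)) expRN; field.
by rewrite !lt0r_neq0 ?expR_gt0.
Qed.

Lemma ler_mixing_potential r r' : r <= r' -> W r <= W r'.
Proof.
move=> rr'; apply: lerD; first by rewrite ler_wpM2r // invr_ge0 ltW.
rewrite ler_wpM2r ?(ltW mixing_bound_gt0) // lerB // ler_expR lerN2.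
by rewrite ler_wpM2r ?invr_ge0 ?(ltW t1) // ler_wpM2l // mulr_ge0 // ltW.
Qed.

Lemma mixing_potential_le r : r <= 1 -> W r <= B.
Proof. by move=> ?; rewrite -mixing_potential1 ler_mixing_potential. Qed.

Lemma mixing_potential_ge r : 0 <= r -> r <= W r.
Proof.
move=> r0; rewrite /W -[leLHS]addr0; apply: lerD.
  by rewrite ler_pdivlMr // ler_piMr // gerBl ltW.
rewrite mulr_ge0 ?(ltW mixing_bound_gt0) // subr_ge0 expRN_le1 //.
by rewrite !mulr_ge0 ?invr_ge0 ?(ltW t1) ?(ltW t0).
Qed.

(** Since [W] is at most a multiple of the distance, the additive gain [W - d] of [transfer_mixing]
    becomes a multiplicative contraction. *)
Lemma mixing_potential_linear r : 0 <= r ->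
  W r <= r * ((1 - theta)^-1 + K * theta / (1 - theta) * B).
Proof.
move=> r0; rewrite /W mulrDr; apply: lerD => //.
have -> : r * (K * theta / (1 - theta) * B) = K * theta * r / (1 - theta) * B.
  by ring.
apply: ler_wpM2r; first exact/ltW/mixing_bound_gt0.
by rewrite lerBlDr -lerBlDl expR_ge1Dx.
Qed.

(** Drift inequality for the coupled chain. It rests on [theta r + theta (theta r) / (1 - theta) =
    theta r / (1 - theta)]: matching now and surviving from distance [theta r] has the same
    probability as surviving from [r]. *)
Lemma mixing_potential_step r (p := expR (- (K * theta * r))) : 0 <= r <= 1 ->
  p * W (theta * r) + (1 - p) * B <= W r - r.
Proof.
move=> /andP[r0 r1].
have p1 : p <= 1 by rewrite expRN_le1 // !mulr_ge0 // ltW.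
have pE : p * expR (- (K * theta * (theta * r) / (1 - theta)))
    = expR (- (K * theta * r / (1 - theta))).
  rewrite /p -expRD; congr expR; field.
  by rewrite lt0r_neq0.
rewrite /W mulrDr [p * (_ * B)]mulrA mulrBr pE mulr1.
have : p * (theta * r / (1 - theta)) <= theta * r / (1 - theta).
  by rewrite ler_piMl // !mulr_ge0 ?invr_ge0 // ltW.
have -> : r / (1 - theta) = theta * r / (1 - theta) + r.
  by field; rewrite lt0r_neq0.
lra.
Qed.

Lemma transfer_mixing f c : 0 <= c ->
  (forall x y, `|f x - f y| <= c * W (d x y)) ->
  forall x y, `|L f x - L f y| <= c * (W (d x y) - d x y).
Proof.
move=> c0 fW x y; set p := expR (- (K * theta * d x y)).
have p01 : 0 <= p <= 1.
  by rewrite expR_ge0 expRN_le1 // !mulr_ge0 ?dist_ge0 // ltW.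
(* Only the distance of the pair enters, so the one-sided bound also serves for the swapped pair and
   yields the absolute value. *)
have main x' y' : d x' y' = d x y -> L f x' - L f y' <= c * (W (d x y) - d x y).
  move=> e; have d01 : 0 <= d x y <= 1 by rewrite dist_ge0 ?dist_le1.
  apply: le_trans (ler_wpM2l c0 (mixing_potential_step d01)).
  rewrite -/p mulrDr [c * (p * _)]mulrCA [c * (_ * B)]mulrCA.
  apply: (transfer_coupling psi1) => //.
  - move=> b; rewrite -expRD ler_expR; have := psiK (scons b x') (scons b y').
    rewrite dist_scons // e ler_norml => /andP[_].
    by rewrite mulrA; lra.
  - move=> b; rewrite (le_trans (ler_norm _)) // (le_trans (fW _ _)) //.
    by rewrite dist_scons // e.
  - move=> u v; rewrite (le_trans (ler_norm _)) // (le_trans (fW _ _)) //.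
    by rewrite ler_wpM2l // mixing_potential_le // dist_le1.
rewrite ler_norml main // andbT lerNl opprB main //.
by rewrite /dist; case: pselect => h; case: pselect => h' //;
   [congr (_ ^+ _); apply: eq_ex_minn => n; rewrite eq_sym
   |exfalso; apply: h'; case: h => n hn; exists n; rewrite eq_sym
   |exfalso; apply: h; case: h' => n hn; exists n; rewrite eq_sym].
Qed.

End Contraction.

(** * Bounded measurable functions on the shift *)

Section BoundedMeasurable.
Context {d : measure_display} {T : measurableType d} {R : realType}.
Context {P : probability T R}.
Implicit Types (f g : T -> R) (A B : set T).

Definition bounded_measurable f :=
  measurable_fun setT f /\ exists M, forall x, `|f x| <= M.

Lemma bounded_measurable_integrable f :
  bounded_measurable f -> P.-integrable setT (EFin \o f).
Proof.
move=> [mf [M fM]]; apply: measurable_bounded_integrable => //.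
  by rewrite (le_lt_trans (probability_le1 _ _)) // ltry.
exists M; split; first by rewrite num_real.
by move=> r Mr x _; apply: le_trans (fM x) (ltW Mr).
Qed.

Lemma bounded_measurable_cst c : bounded_measurable (fun=> c).
Proof. by split; [exact: measurable_cst|exists `|c|]. Qed.

Lemma bounded_measurableD f g : bounded_measurable f -> bounded_measurable g ->
  bounded_measurable (fun x => f x + g x).
Proof.
move=> [mf [M fM]] [mg [M' gM]]; split; first exact: measurable_funD.
by exists (M + M') => x; rewrite (le_trans (ler_normD _ _)) // lerD.
Qed.

Lemma bounded_measurableZ c f : bounded_measurable f ->
  bounded_measurable (fun x => c * f x).
Proof.
move=> [mf [M fM]]; split; first exact: measurable_funM.
by exists (`|c| * M) => x; rewrite normrM ler_wpM2l.
Qed.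

Lemma bounded_measurable_sum (I : Type) (r : seq I) (F : I -> T -> R) :
  (forall i, bounded_measurable (F i)) ->
  bounded_measurable (fun x => \sum_(i <- r) F i x).
Proof.
move=> mF; elim: r => [|i r IH].
  by under eq_fun do rewrite big_nil; exact: bounded_measurable_cst.
by under eq_fun do rewrite big_cons; exact: bounded_measurableD.
Qed.

Lemma bounded_measurable_indic A : measurable A ->
  bounded_measurable (\1_A : T -> R).
Proof.
move=> mA; split; first exact: measurable_indic.
by exists 1 => x; rewrite indicE; case: (x \in A); rewrite ?normr1 // normr0.
Qed.

Lemma expect_cst c : \int[P]_x (c : R) = c.
Proof. rewrite Rintegral_cst //. by rewrite /= (probability_setT P) mulr1. Qed.

Lemma expectD f g : bounded_measurable f -> bounded_measurable g ->
  \int[P]_x (f x + g x) = \int[P]_x f x + \int[P]_x g x.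
Proof. by move=> mf mg; rewrite RintegralD //; exact: bounded_measurable_integrable. Qed.

Lemma expectZ c f : bounded_measurable f ->
  \int[P]_x (c * f x) = c * \int[P]_x f x.
Proof. by move=> mf; rewrite RintegralZl //; exact: bounded_measurable_integrable. Qed.

Lemma ler_expect f g : bounded_measurable f -> bounded_measurable g ->
  (forall x, f x <= g x) -> \int[P]_x f x <= \int[P]_x g x.
Proof.
move=> mf mg fg; apply: le_Rintegral => // ; exact: bounded_measurable_integrable.
Qed.

Lemma expect_sum (I : Type) (r : seq I) (F : I -> T -> R) :
  (forall i, bounded_measurable (F i)) ->
  \int[P]_x (\sum_(i <- r) F i x) = \sum_(i <- r) \int[P]_x F i x.
Proof.
move=> mF; elim: r => [|i r IH].
  under eq_Rintegral do rewrite big_nil.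
  by rewrite big_nil expect_cst.
under eq_Rintegral do rewrite big_cons.
by rewrite big_cons expectD ?IH //; exact: bounded_measurable_sum.
Qed.

Lemma expect_indic A : measurable A -> \int[P]_x (\1_A x : R) = fine (P A).
Proof. by move=> mA; rewrite /Rintegral integral_indic // setIT. Qed.

Section FiniteCode.
Context {I : finType} (k : T -> I).
Hypothesis mk : forall i, measurable [set x | k x = i].

Let codeE (F : I -> R) : (fun x => F (k x)) =
  fun x => \sum_i F i * \1_[set x | k x = i] x.
Proof.
apply/funext => x; rewrite (bigD1 (k x)) //= big1 ?addr0.
  by rewrite indicE mem_set ?mulr1.
by move=> i /eqP ik; rewrite indicE memNset ?mulr0 // => /esym.
Qed.

Lemma bounded_measurable_code (F : I -> R) : bounded_measurable (fun x => F (k x)).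
Proof.
rewrite codeE; apply: bounded_measurable_sum => i.
exact/bounded_measurableZ/bounded_measurable_indic.
Qed.

Lemma expect_code (F : I -> R) :
  \int[P]_x F (k x) = \sum_i F i * fine (P [set x | k x = i]).
Proof.
rewrite codeE expect_sum => [|i]; last exact/bounded_measurableZ/bounded_measurable_indic.
apply: eq_bigr => i _; rewrite expectZ ?expect_indic //.
exact: bounded_measurable_indic.
Qed.

End FiniteCode.

Lemma fine_probability_ge0 A : 0 <= fine (P A).
Proof. exact/fine_ge0/measure_ge0. Qed.

End BoundedMeasurable.
Arguments bounded_measurable {d T R} f.

(** * Words, cylinders and measurability on the shift space *)

Section Shift.
Context {R : realType} {S : finType} {s0 : S}.
Local Notation T := (shiftA s0).
Implicit Types (A : set T) (x y : nat -> S).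

Definition word (k : nat) (x : nat -> S) : k.-tuple S := [tuple x i | i < k].

Lemma nth_word k x i : (i < k)%N -> nth s0 (word k x) i = x i.
Proof. by move=> ik; rewrite -[i]/(val (Ordinal ik)) -tnth_nth tnth_mktuple. Qed.

Lemma word_eqP k x (w : k.-tuple S) :
  word k x = w <-> forall i, (i < k)%N -> x i = nth s0 w i.
Proof.
split=> [<- i ik|xw]; first by rewrite nth_word.
by apply/eq_from_tnth => i; rewrite tnth_mktuple xw // (tnth_nth s0).
Qed.

Lemma measurable_coord i (s : S) : measurable ([set x | x i = s] : set T).
Proof. by apply: sub_sigma_algebra; exists i, s. Qed.

Lemma measurable_word k (w : k.-tuple S) : measurable ([set x | word k x = w] : set T).
Proof.
rewrite (_ : [set x | _] = \bigcap_(i in [set i | (i < k)%N]) [set x | x i = nth s0 w i]).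
  by apply: bigcap_measurableType => i _; exact: measurable_coord.
by apply/seteqP; split=> x /= /word_eqP.
Qed.

Definition determined (k : nat) A :=
  forall x y, (forall i, (i < k)%N -> x i = y i) -> A x -> A y.

Lemma determinedE k A : determined k A ->
  A = \bigcup_(w in [set w : k.-tuple S | A (nth s0 w)]) [set x | word k x = w].
Proof.
move=> Ak; apply/seteqP; split=> x /=.
  by move=> Ax; exists (word k x) => //=; apply: Ak Ax => i ik; rewrite nth_word.
by move=> [w /= Aw /word_eqP xw]; apply: Ak Aw => i ik; rewrite xw.
Qed.

Lemma determined_measurable k A : determined k A -> measurable A.
Proof.
move=> /determinedE ->; apply: fin_bigcup_measurable => // w _.
exact: measurable_word.
Qed.

Lemma determined_coord i (s : S) : determined i.+1 [set x | x i = s].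
Proof. by move=> x y xy /= <-; rewrite xy. Qed.

Lemma measurable_determined_fun k (f : T -> R) :
  (forall x y, (forall i, (i < k)%N -> x i = y i) -> f x = f y) ->
  measurable_fun setT f.
Proof.
move=> fk _ B mB; rewrite setTI; apply: (@determined_measurable k).
by move=> x y xy /=; rewrite (fk _ _ xy).
Qed.

(** Replacing all coordinates from [n] on by [s0] gives functions of finitely many coordinates,
    which converge to [f] with error at most [K * theta ^+ n]. *)
Lemma lipschitz_measurable (theta : R) (f : T -> R) : 0 < theta < 1 ->
  theta_lip theta f -> measurable_fun setT f.
Proof.
move=> th [K K0 fK].
pose h n (x : T) := f (fun i => if (i < n)%N then x i else s0).
apply: (@measurable_fun_cvg _ _ _ setT h).
  move=> n; apply: (@measurable_determined_fun n) => x y xy.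
  by congr f; apply/funext => i; case: ifP => // /xy.
move=> x _; apply: (@squeeze_cvgr _ _ _ _ (fun n => f x - K * theta ^+ n)
   (fun n => f x + K * theta ^+ n)).
- near=> n; rewrite -ler_distl distrC (le_trans (fK _ _)) // ler_wpM2l //.
  by apply: dist_le_expn => // i ->.
- rewrite -[X in _ --> X]subr0; apply: cvgB; first exact: cvg_cst.
  by apply: (@cvg_geometric _ K theta); case/andP: th => t0 t1; rewrite gtr0_norm.
- rewrite -[X in _ --> X]addr0; apply: cvgD; first exact: cvg_cst.
  by apply: (@cvg_geometric _ K theta); case/andP: th => t0 t1; rewrite gtr0_norm.
Unshelve. all: by end_near. Qed.

Lemma lipschitz_bounded_measurable (theta : R) (f : T -> R) : 0 < theta < 1 ->
  theta_lip theta f -> bounded_measurable f.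
Proof.
move=> th lf; split; first exact: lipschitz_measurable lf.
by have [M _ fM] := lipschitz_bounded th lf; exists M.
Qed.

Lemma measurable_left_shift : measurable_fun setT (@left_shift S : T -> T).
Proof.
apply: measurability => // _ [_ [i [s ->]] <-].
by rewrite setTI; exact: (measurable_coord i.+1).
Qed.

Lemma bounded_measurable_left_shift (f : T -> R) :
  bounded_measurable f -> bounded_measurable (fun x : T => f (left_shift x)).
Proof.
move=> [mf [M fM]]; split; last by exists M.
exact: measurableT_comp mf measurable_left_shift.
Qed.

Lemma expect_left_shift (mu : probability T R) (f : T -> R) :
  shift_invariant mu -> bounded_measurable f ->
  \int[mu]_x f (left_shift x) = \int[mu]_x f x.
Proof.
move=> muI mf; rewrite /Rintegral; congr fine.
have := @integral_pushforward _ _ _ _ _ _ measurable_left_shift mu setT (EFin \o f).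
move=> /(_ _ _ measurableT) /= <-.
- apply: eq_measure_integral; first exact: measurable_left_shift.
  by move=> mS A mA _; exact: muI.
- by case: mf => mf _; apply/measurable_EFinP.
- exact/bounded_measurable_integrable/bounded_measurable_left_shift.
Qed.

Lemma expect_iter_left_shift (mu : probability T R) (f : T -> R) n :
  shift_invariant mu -> bounded_measurable f ->
  bounded_measurable (fun x : T => f (iter n left_shift x)) /\
  \int[mu]_x f (iter n left_shift x) = \int[mu]_x f x.
Proof.
move=> muI mf; elim: n => [//|n [mn <-]].
under eq_fun do rewrite iterSr.
split; first exact: (@bounded_measurable_left_shift (fun x => f (iter n left_shift x))).
exact: (@expect_left_shift mu (fun x => f (iter n left_shift x))).
Qed.

End Shift.

(** * Gibbs' inequality and approximation by cylinders *)

Section Gibbs.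
Context {d : measure_display} {T : measurableType d} {R : realType}.
Context {P : probability T R}.

Lemma le_fine_probability (A B : set T) : measurable A -> measurable B ->
  A `<=` B -> fine (P A) <= fine (P B).
Proof.
by move=> mA mB AB; rewrite fine_le ?fin_num_measure // le_measure ?inE.
Qed.

Lemma fine_probabilityU (A B : set T) : measurable A -> measurable B ->
  fine (P (A `|` B)) <= fine (P A) + fine (P B).
Proof.
move=> mA mB; rewrite -fineD ?fin_num_measure // fine_le ?fin_num_measure //.
- exact: measurableU.
- by rewrite fin_numD !fin_num_measure.
- exact: measureU2.
Qed.

Lemma fine_probability_bigsetU (I : Type) (r : seq I) (F : I -> set T) :
  (forall i, measurable (F i)) ->
  fine (P (\big[setU/set0]_(i <- r) F i)) <= \sum_(i <- r) fine (P (F i)).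
Proof.
move=> mF; elim: r => [|i r IH]; first by rewrite !big_nil measure0.
rewrite !big_cons (le_trans (fine_probabilityU _ _)) //; last by rewrite lerD2l.
exact: bigsetU_measurable.
Qed.

Context {I J : finType} (k1 : T -> I) (k2 : T -> J).
Hypothesis m1 : forall i, measurable [set x | k1 x = i].
Hypothesis m2 : forall j, measurable [set x | k2 x = j].

Lemma measurable_pair_code ij : measurable [set x | (k1 x, k2 x) = ij].
Proof.
rewrite (_ : [set x | _] = [set x | k1 x = ij.1] `&` [set x | k2 x = ij.2]).
  exact: measurableI.
by apply/seteqP; split => x /=; [move=> <-|case: ij => i j /= [-> ->]].
Qed.

(* Gibbs' inequality; the auxiliary code [k2] only serves to choose [q] well. *)
Lemma code_entropy_le (q : I -> J -> R) : (forall i j, 0 < q i j) ->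
  \sum_i \sum_j q i j <= 1 ->
  \sum_i (let p := fine (P [set x | k1 x = i]) in - (p * ln p))
  <= \int[P]_x - ln (q (k1 x) (k2 x)).
Proof.
move=> q0 q1; set p1 := fun i => fine (P [set x | k1 x = i]).
set p := fun ij => fine (P [set x | (k1 x, k2 x) = ij]).
have -> : \sum_i (let p := fine (P [set x | k1 x = i]) in - (p * ln p))
    = \sum_ij - ln (p1 ij.1) * p ij.
  rewrite -(expect_code measurable_pair_code (fun ij => - ln (p1 ij.1))).
  rewrite (expect_code m1 (fun i => - ln (p1 i))).
  by apply: eq_bigr => i _; rewrite mulNr mulrC.
rewrite (expect_code measurable_pair_code (fun ij => - ln (q ij.1 ij.2))).
rewrite -/p -subr_ge0 -sumrB.
(* This sum is nonnegative because [p] has total mass 1 and [q] at most 1. The termwise comparison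
   is [ln t <= t - 1] at [t = q / p], combined with [p <= p1]: the joint mass is at most the
   marginal one. *)
apply: (@le_trans _ _ (\sum_ij (p ij - q ij.1 ij.2))).
  rewrite sumrB -(pair_bigA _ (fun i j => q i j)) /=.
  have /= := expect_code measurable_pair_code (fun=> 1 : R) (P := P).
  rewrite expect_cst; under eq_bigr do rewrite mul1r.
  by rewrite -/p => <-; rewrite subr_ge0.
apply: ler_sum => -[i j] _ /=; rewrite -mulrBl opprK.
have pp1 : p (i, j) <= p1 i.
  apply: le_fine_probability => //; first exact: measurable_pair_code.
  by move=> x /= [-> _].
have := @fine_probability_ge0 _ _ _ P [set x | (k1 x, k2 x) = (i, j)].
rewrite -/(p (i, j)) le_eqVlt => /predU1P[<-|pij0].
  by rewrite mulr0 sub0r oppr_le0 ltW.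
have h : ln (q i j) - ln (p (i, j)) <= q i j / p (i, j) - 1.
  rewrite -ln_div ?posrE //.
  have := @le_ln1Dx _ (q i j / p (i, j) - 1); rewrite [1 + _]addrC subrK; apply.
  by have := divr_gt0 (q0 i j) pij0; lra.
have h' : ln (p (i, j)) <= ln (p1 i) by rewrite ler_ln ?posrE // (lt_le_trans pij0).
have : (ln (q i j) - ln (p1 i)) * p (i, j) <= (q i j / p (i, j) - 1) * p (i, j).
  by rewrite ler_wpM2r ?(ltW pij0) //; lra.
rewrite [leRHS]mulrBl mul1r divfK ?lt0r_neq0 //.
lra.
Qed.

End Gibbs.

(** * Approximation of measurable sets by finite-coordinate sets *)

Section Approximation.
Context {R : realType} {S : finType} {s0 : S} {mu : probability (shiftA s0) R}.
Local Notation T := (shiftA s0).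
Implicit Types (A B : set T).

Definition approximable B := measurable B /\ forall e : R, 0 < e ->
  exists k A, determined k A /\ fine (mu ((B `\` A) `|` (A `\` B))) < e.

Lemma approximable_determined k A : determined k A -> approximable A.
Proof.
move=> Ak; split; first exact: determined_measurable Ak.
by move=> e e0; exists k, A; split => //; rewrite setDv setU0 measure0.
Qed.

Lemma approximableC B : approximable B -> approximable (~` B).
Proof.
move=> [mB aB]; split; first exact: measurableC.
move=> e /aB [k [A [Ak BA]]]; exists k, (~` A); split.
  by move=> x y xy; apply: contra_not => Ay; apply: Ak Ay => i ik; rewrite xy.
by rewrite !setDE !setCK setUC [_ `&` B]setIC [_ `&` A]setIC -!setDE.
Qed.

Lemma approximableU B B' : approximable B -> approximable B' -> approximable (B `|` B').
Proof.
move=> [mB aB] [mB' aB']; split; first exact: measurableU.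
move=> e e0; have e2 : 0 < e / 2 by rewrite divr_gt0.
have [k [A [Ak BA]]] := aB _ e2; have [k' [A' [Ak' BA']]] := aB' _ e2.
have mA := determined_measurable Ak; have mA' := determined_measurable Ak'.
exists (maxn k k'), (A `|` A'); split.
  move=> x y xy [Ax|Ax]; [left|right].
    by apply: Ak Ax => i ik; rewrite xy // leq_max ik.
  by apply: Ak' Ax => i ik; rewrite xy // leq_max ik orbT.
rewrite [ltRHS]splitr; apply: le_lt_trans (ltrD BA BA').
have mD : measurable ((B `\` A) `|` (A `\` B)) by apply: measurableU; exact: measurableD.
have mD' : measurable ((B' `\` A') `|` (A' `\` B')) by apply: measurableU; exact: measurableD.
apply: le_trans (fine_probabilityU mD mD'); apply: le_fine_probability.
- by apply: measurableU; apply: measurableD; exact: measurableU.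
- exact: measurableU.
- move=> x [[[Bx|Bx] /not_orP[Ax A'x]]|[[Ax|Ax] /not_orP[Bx B'x]]].
  + by left; left.
  + by right; left.
  + by left; right.
  + by right; right.
Qed.

(** By continuity from above, a finite subunion misses mass less than [e / 2]; that subunion is
    approximated with the other [e / 2]. *)
Lemma approximable_bigcup (F : (set T)^nat) :
  (forall n, approximable (F n)) -> approximable (\bigcup_n F n).
Proof.
move=> aF; have mF n : measurable (F n) by case: (aF n).
have mU : measurable (\bigcup_n F n) by exact: bigcupT_measurable.
split=> // e e0; have e2 : 0 < e / 2 by rewrite divr_gt0.
pose V n : set T := \big[setU/set0]_(i < n) F i.
have aV n : approximable (V n).
  rewrite /V; elim/big_ind : _ => [|? ?|i _]; last exact: aF.
    by apply: (@approximable_determined 0).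
  exact: approximableU.
have mV n : measurable (V n) by case: (aV n).
pose D n := \bigcup_n F n `\` V n.
have mD n : measurable (D n) by exact: measurableD.
have D0 : \bigcap_n D n = set0.
  apply/seteqP; split => // x Dx; have [[n _ Fx] _] := Dx 0 I.
  have [_] := Dx n.+1 I; apply.
  by rewrite /V big_ord_recr; right.
have := @nonincreasing_cvg_mu _ _ _ mu D.
rewrite D0 measure0 => /(_ _ mD measurable0 _) cD.
have {}cD : (mu \o D) x @[x --> \oo] --> (0 : \bar R).
  apply: cD; first by rewrite (le_lt_trans (probability_le1 _ _)) // ltry.
  move=> n m nm; apply/subsetPset; apply: setDS => x.
  rewrite /V -!bigcup_mkord => -[i /= ik Fx]; exists i => //=.
  exact: leq_trans nm.
have : \forall n \near \oo, (mu (D n) < (e / 2)%:E)%E.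
  have /fine_cvgP [_ /cvgr_lt] := cD.
  move=> /(_ _ e2) h; near=> n.
  rewrite -[mu _]fineK ?fin_num_measure // lte_fin.
  by near: n.
move=> [n _ /(_ n (leqnn n))] Dn.
have [k [A [Ak VA]]] := (aV n).2 _ e2.
exists k, A; split => //.
have mA := determined_measurable Ak.
have mVA : measurable ((V n `\` A) `|` (A `\` V n)).
  by apply: measurableU; exact: measurableD.
rewrite [ltRHS]splitr.
have Dn' : fine (mu (D n)) < e / 2.
  by rewrite -lte_fin fineK ?fin_num_measure.
apply: le_lt_trans (ltrD Dn' VA).
apply: le_trans (fine_probabilityU _ _) => //; apply: le_fine_probability.
- by apply: measurableU; apply: measurableD.
- exact: measurableU.
- have VF : V n `<=` \bigcup_n F n.
    by rewrite /V -bigcup_mkord => x [i _ Fx]; exists i.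
  move=> x [[Fx Ax]|[Ax Fx]]; last by right; right; split => // /VF.
  by have [Vx|Vx] := pselect (V n x); [right; left|left].
Unshelve. all: by end_near. Qed.

(** The approximable sets form a sigma-algebra containing the generating coordinate sets. *)
Lemma measurable_approximable B : measurable B -> approximable B.
Proof.
apply: smallest_sub.
  split=> [|A aA|F aF]; last exact: approximable_bigcup.
    by apply: (@approximable_determined 0).
  by rewrite setTD; exact: approximableC.
by move=> A [i [s ->]]; apply: approximable_determined; exact: determined_coord.
Qed.

End Approximation.

(** * Entropy bound from normalized potentials *)

Definition birkhoff {R : realType} {S : Type} (psi : (nat -> S) -> R) (n : nat)
    (x : nat -> S) : R :=
  \sum_(i < n) psi (iter i left_shift x).

Section Birkhoff.
Context {R : realType} {S : finType} {theta : R}.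
Hypothesis (htheta : 0 < theta < 1).
Implicit Types (psi : (nat -> S) -> R) (x y : nat -> S).

Lemma birkhoff0 psi x : birkhoff psi 0 x = 0.
Proof. exact: big_ord0. Qed.

Lemma birkhoffS psi n x :
  birkhoff psi n.+1 x = psi x + birkhoff psi n (left_shift x).
Proof.
by rewrite /birkhoff big_ord_recl; congr (_ + _); apply: eq_bigr => i _; rewrite -iterSr.
Qed.

Lemma birkhoff_scons psi n b x :
  birkhoff psi n.+1 (scons b x) = psi (scons b x) + birkhoff psi n x.
Proof. exact: birkhoffS. Qed.

Lemma iter_left_shift n x i : iter n left_shift x i = x (i + n)%N.
Proof. by elim: n i => [|n IH] i; rewrite ?addn0 //= /left_shift IH addSnnS. Qed.

Lemma nth_scons (s0 b : S) (w : seq S) : nth s0 (b :: w) = scons b (nth s0 w).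
Proof. by apply/funext => -[]. Qed.

Lemma big_tuple_cons (n : nat) (F : n.+1.-tuple S -> R) :
  \sum_w F w = \sum_b \sum_(w : n.-tuple S) F (cons_tuple b w).
Proof.
rewrite pair_bigA /= (reindex (fun p : S * n.-tuple S => cons_tuple p.1 p.2)) //.
exists (fun w => (thead w, behead_tuple w)) => [[b w] _|w _] /=.
  by rewrite theadE; congr pair; exact: val_inj.
by rewrite [RHS]tuple_eta; exact: val_inj.
Qed.

(** Normalization sums out the leading symbol at each length. The weights form a probability on
    words, each word being continued by the constant [s0]; it is the test distribution fed to Gibbs'
    inequality. *)
Lemma sum_expR_birkhoff (s0 : S) psi m :
  (forall x, \sum_(b : S) expR (psi (scons b x)) = 1) ->
  \sum_(w : m.-tuple S) expR (birkhoff psi m (nth s0 w)) = 1.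
Proof.
move=> psi1; elim: m => [|m IH].
  rewrite (big_pred1 [tuple]); last by move=> w; apply/esym/eqP; exact: tuple0.
  by rewrite birkhoff0 expR0.
rewrite big_tuple_cons exchange_big /= -[RHS]IH; apply: eq_bigr => w _.
under eq_bigr do rewrite nth_scons birkhoff_scons expRD.
by rewrite -mulr_suml psi1 mul1r.
Qed.

Lemma birkhoff_distortion psi K m x y : 0 <= K ->
  (forall x y, `|psi x - psi y| <= K * dist theta x y) ->
  (forall i, (i < m)%N -> x i = y i) ->
  `|birkhoff psi m x - birkhoff psi m y| <= K / (1 - theta).
Proof.
case/andP: (htheta) => t0 t1 K0 psiK xy.
have t1' : 0 < 1 - theta by rewrite subr_gt0.
(* The induction needs the exact partial geometric sum: while [m] symbols still agree, the current
   terms differ by at most [K * theta ^+ m]. *)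
suff h : `|birkhoff psi m x - birkhoff psi m y|
         <= K * theta * (1 - theta ^+ m) / (1 - theta).
  apply: le_trans h _; apply: ler_wpM2r; first by rewrite invr_ge0 ltW.
  rewrite -mulrA; apply: ler_piMr => //; apply: mulr_ile1; rewrite ?(ltW t0) ?(ltW t1) //.
    by rewrite subr_ge0 exprn_ile1 ?ltW.
  by rewrite gerBl exprn_ge0 ?ltW.
elim: m x y xy => [|m IH] x y xy.
  by rewrite !birkhoff0 subrr normr0 expr0 subrr mulr0 mul0r.
rewrite !birkhoffS opprD addrACA (le_trans (ler_normD _ _)) //.
have -> : K * theta * (1 - theta ^+ m.+1) / (1 - theta) =
   K * theta ^+ m.+1 + K * theta * (1 - theta ^+ m) / (1 - theta).
  by rewrite exprS; field; rewrite lt0r_neq0.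
apply: lerD; last by apply: IH => i im; exact: xy.
by rewrite (le_trans (psiK _ _)) // ler_wpM2l // dist_le_expn.
Qed.

Lemma lipschitz_birkhoff psi n : theta_lip theta psi -> theta_lip theta (birkhoff psi n).
Proof.
move=> lpsi; elim: n => [|n IH].
  by rewrite (_ : birkhoff psi 0 = fun=> 0); [exact: lipschitz_cst|
    apply/funext => x; rewrite birkhoff0].
rewrite (_ : birkhoff _ _ = fun x => psi x + birkhoff psi n (left_shift x)).
  by apply: lipschitzD => //; exact: (lipschitz_left_shift htheta IH).
by apply/funext => x; rewrite birkhoffS.
Qed.

End Birkhoff.

Section EntropyUpperBound.
Context {R : realType} {S : finType} {s0 : S} {theta : R}.
Hypothesis (htheta : 0 < theta < 1).
Local Notation T := (shiftA s0).
Context {mu : probability T R}.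
Hypothesis muI : shift_invariant mu.

Lemma expect_birkhoff (psi : (nat -> S) -> R) n : theta_lip theta psi ->
  \int[mu]_x birkhoff psi n x = n%:R * \int[mu]_x psi x.
Proof.
move=> lpsi; have bpsi := lipschitz_bounded_measurable (s0 := s0) htheta lpsi.
rewrite expect_sum => [|i]; last first.
  exact: (expect_iter_left_shift i muI bpsi).1.
under eq_bigr do rewrite (expect_iter_left_shift _ muI bpsi).2.
by rewrite sumr_const card_ord mulr_natl.
Qed.

Context {psi : (nat -> S) -> R}.
Hypothesis lpsi : theta_lip theta psi.
Hypothesis psi1 : forall x, \sum_(b : S) expR (psi (scons b x)) = 1.

Let psi_le0 : \int[mu]_x psi x <= 0.
Proof.
have bpsi := lipschitz_bounded_measurable (s0 := s0) htheta lpsi.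
rewrite -(expect_left_shift muI bpsi) -[leRHS](expect_cst (P := mu)).
rewrite (expect_left_shift muI bpsi).
apply: ler_expect => // [|x]; first exact: bounded_measurable_cst.
have -> : x = scons (x 0) (left_shift x) by apply/funext => -[].
rewrite -ler_expR expR0 -(psi1 (left_shift x)) (bigD1 (x 0)) //= lerDl.
by apply: sumr_ge0 => b _; exact: expR_ge0.
Qed.

Context {K : nat} {P : 'I_K -> set T}.
Hypothesis hP : is_fin_partition P.

Let mP i : measurable (P i). Proof. by case: hP. Qed.

Let cellP x : exists i, P i x. Proof. by case: hP => _ []. Qed.
Let cell (x : T) : 'I_K := projT1 (cid (cellP x)).
Let cell_in x : P (cell x) x. Proof. exact: projT2 (cid (cellP x)). Qed.

Let cellE x i : P i x <-> cell x = i.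
Proof.
split=> [Pix|<-]; last exact: cell_in.
apply/eqP; apply: contrapT => /negP ne.
case: hP => _ [/(_ _ _ ne) + _]; rewrite -subset0 => /(_ x); apply.
by split=> //; exact: cell_in.
Qed.

Let itinerary n (x : T) : {ffun 'I_n -> 'I_K} :=
  [ffun i : 'I_n => cell (iter i left_shift x)].

Let itineraryE n (w : {ffun 'I_n -> 'I_K}) :
  [set x : T | forall i : 'I_n, P (w i) (iter i left_shift x)] =
  [set x | itinerary n x = w].
Proof.
apply/seteqP; split=> x /= h.
  by apply/ffunP => i; rewrite ffunE; apply/cellE.
by move=> i; apply/cellE; rewrite -h ffunE.
Qed.

Let measurable_iter i : measurable_fun setT (iter i left_shift : T -> T).
Proof.
elim: i => [|i IH]; first exact: measurable_id.
exact: measurableT_comp measurable_left_shift IH.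
Qed.

Let measurable_itinerary n w : measurable [set x | itinerary n x = w].
Proof.
rewrite -itineraryE (_ : [set x | _] = \bigcap_(i in [set: 'I_n])
   (iter i left_shift @^-1` P (w i))).
  apply: fin_bigcap_measurable => // i _.
  by rewrite -[_ @^-1` _]setTI; exact: measurable_iter.
by apply/seteqP; split=> x /= h i; [move=> _; exact: h|exact: h].
Qed.

(* A guess of the cell from finitely many coordinates, wrong with small
   probability. *)
Let guessP (e : R) : 0 < e -> exists k (J : T -> 'I_K) (D : set T),
  [/\ forall x y, (forall i, (i < k)%N -> x i = y i) -> J x = J y,
      measurable D, fine (mu D) <= e & forall x, ~ D x -> J x = cell x].
Proof.
move=> e0; have K0 : 0 < (K%:R : R).
  by rewrite ltr0n; case: (cell (fun=> s0)) => m; exact: leq_ltn_trans.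
pose good i (A : set T) k :=
  determined k A /\ fine (mu ((P i `\` A) `|` (A `\` P i))) < e / K%:R.
have /choice [A Ak] : forall i, exists A, exists k, good i A k.
  move=> i; have [_ /(_ _ (divr_gt0 e0 K0))] := measurable_approximable (mP i) (mu := mu).
  by move=> [k [A h]]; exists A, k.
have {Ak} /choice [k gA] := Ak.
(* Outside the bad set the [A i] coincide with the cells, so the choice is forced there; the default
   is only reached inside the bad set. *)
pose J x := odflt (cell (fun=> s0)) [pick i | `[< A i x >]].
pose D i := (P i `\` A i) `|` (A i `\` P i).
have mA i : measurable (A i) by exact: determined_measurable (gA i).1.
have mD i : measurable (D i) by apply: measurableU; exact: measurableD.
exists (\max_i k i), J, (\big[setU/set0]_i D i); split.
- move=> x y xy; rewrite /J; congr odflt; apply: eq_pick => i; apply: asbool_equiv_eq.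
  split; apply: (gA i).1 => j jk; [|apply/esym]; apply: xy;
    apply: leq_trans jk _; exact: leq_bigmax.
- exact: bigsetU_measurable.
- apply: (le_trans (fine_probability_bigsetU _ mD)).
  apply: (@le_trans _ _ (\sum_(i < K) e / K%:R)).
    by apply: ler_sum => i _; exact: ltW (gA i).2.
  by rewrite sumr_const card_ord -[_ *+ _]mulr_natl mulrCA divff ?mulr1 ?lt0r_neq0.
- move=> x nD; have nDi i : ~ D i x.
    by move=> Dx; apply: nD; rewrite (bigD1 i) //; left.
  have AP i : A i x <-> P i x.
    split=> h; apply: contrapT => h'; apply: (nDi i); by [right|left].
  rewrite /J; case: pickP => [i /asboolP /AP /cellE <- //|/(_ (cell x))].
  by move/negbT/asboolPn => []; apply/AP.
Qed.

(** Gibbs' inequality for itineraries against the following test law: draw a word with the weights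
    of [psi], guess the cell at each time from it, and perturb each guess independently by [r]. A
    correct guess costs at most [e / 2], and a wrong one at most [M] more, on a set so small that
    its mean cost is again at most [e / 2]. *)
Let partition_entropy_n_le (e : R) : 0 < e -> exists C, forall n,
  part_entropy_n mu P n <= n%:R * (e - \int[mu]_x psi x) + C.
Proof.
move=> e0; have K0 : 0 < (K%:R : R).
  by rewrite ltr0n; case: (cell (fun=> s0)) => m; exact: leq_ltn_trans.
have K00 : (K%:R : R) != 0 by rewrite lt0r_neq0.
have e2 : 0 < e / 2 by rewrite divr_gt0.
(* Chosen so that [- ln (1 - del) = e / 2], the cost allowed for a correct guess. *)
pose del := 1 - expR (- (e / 2)).
have del0 : 0 < del by rewrite subr_gt0 -[ltRHS]expR0 ltr_expR oppr_lt0.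
have delK : 0 < del / K%:R by rewrite divr_gt0.
(* Keep the guess with probability [1 - del], otherwise draw a uniform cell; the uniform part keeps
   the cost of a wrong guess finite. *)
pose r (i j : 'I_K) := (i == j)%:R * (1 - del) + del / K%:R.
have del1 : 0 < 1 - del by rewrite subKr expR_gt0.
have r0 i j : 0 < r i j by rewrite /r ltr_wpDl // mulr_ge0 // ltW.
have r1 i : \sum_j r i j = 1.
  rewrite big_split /= sumr_const card_ord -[_ *+ _]mulr_natl mulrCA divff // mulr1.
  rewrite (bigD1 i) //= eqxx mul1r big1 ?addr0 ?subrK // => j ji.
  by rewrite eq_sym (negbTE ji) mul0r.
pose M := `|ln (del / K%:R)|.
have M1 : 0 < M + 1 by rewrite ltr_wpDl ?normr_ge0.
have [k [J [D [Jk mD muD JD]]]] := guessP (divr_gt0 e2 M1).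
have r_good i : - ln (r i i) <= e / 2.
  rewrite lerNl -[leLHS]expRK ler_ln ?posrE ?expR_gt0 //.
  by rewrite /r eqxx mul1r subKr lerDl ltW.
have r_bad i j : - ln (r i j) <= M.
  have : ln (del / K%:R) <= ln (r i j).
    by rewrite ler_ln ?posrE // lerDr mulr_ge0 // ltW.
  by have := ler_norm (- ln (del / K%:R)); rewrite normrN -/M; lra.
have r_le (x : T) : - ln (r (J x) (cell x)) <= e / 2 + M * \1_D x.
  have [Dx|Dx] := pselect (D x).
    rewrite indicE mem_set // mulr1 (le_trans (r_bad _ _)) // lerDr ltW //.
  by rewrite indicE memNset // mulr0 addr0 JD.
case: (lpsi) => Kp Kp0 psiK.
(* The distortion paid for replacing [x] by its word continued with [s0], plus the contribution of
   the [k] additional symbols. *)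
exists (Kp / (1 - theta) - k%:R * \int[mu]_x psi x) => n.
(* With [k] symbols beyond [n], the guess at every time [i < n] is a function of the word. *)
pose m := (n + k)%N.
pose Q (w : {ffun 'I_n -> 'I_K}) (c : m.-tuple S) : R :=
  birkhoff psi m (nth s0 c) + \sum_(i < n) ln (r (J (iter i left_shift (nth s0 c))) (w i)).
have q1 : \sum_w \sum_c expR (Q w c) <= 1.
  rewrite exchange_big /= -(sum_expR_birkhoff s0 m psi1) le_eqVlt; apply/orP; left.
  apply/eqP/eq_bigr => c _; under eq_bigr do rewrite expRD [X in _ * X]expR_sum.
  rewrite -mulr_sumr; set z := fun i : 'I_n => J (iter i left_shift (nth s0 c)).
  transitivity (expR (birkhoff psi m (nth s0 c)) *
      \prod_(i < n) \sum_j expR (ln (r (z i) j))); first by rewrite bigA_distr_bigA.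
  rewrite big1 ?mulr1 // => i _; under eq_bigr do rewrite lnK ?posrE //.
  exact: r1.
have := code_entropy_le (P := mu) (@measurable_itinerary n) (@measurable_word _ s0 m)
   (fun i j => expR_gt0 (Q i j)) q1.
have -> : \sum_i (let p := fine (mu [set x | itinerary n x = i]) in - (p * ln p))
    = part_entropy_n mu P n.
  by apply: eq_bigr => w _; rewrite itineraryE.
move=> /le_trans; apply.
have bpsi : bounded_measurable (birkhoff psi m : T -> R).
  exact: lipschitz_bounded_measurable htheta (lipschitz_birkhoff htheta _ lpsi).
have bD := bounded_measurable_indic mD.
have bD' : bounded_measurable (fun x : T => e / 2 + M * \1_D x).
  apply: bounded_measurableD; first exact: bounded_measurable_cst.
  exact: bounded_measurableZ.
have bDi i := (expect_iter_left_shift i muI bD').1.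
have bS : bounded_measurable
    (fun x : T => \sum_(i < n) (e / 2 + M * \1_D (iter i left_shift x))).
  by apply: bounded_measurable_sum => i; exact: bDi.
apply: (@le_trans _ _ (\int[mu]_x (Kp / (1 - theta) + -1 * birkhoff psi m x +
   \sum_(i < n) (e / 2 + M * \1_D (iter i left_shift x))))).
  apply: ler_expect.
  - exact: (bounded_measurable_code (measurable_pair_code (@measurable_itinerary n)
       (@measurable_word _ s0 m)) (fun ij => - ln (expR (Q ij.1 ij.2)))).
  - apply: bounded_measurableD => //; apply: bounded_measurableD.
      exact: bounded_measurable_cst.
    exact: bounded_measurableZ.
  - move=> x; rewrite expRK /Q opprD; apply: lerD.
      have /ler_normlP[_] := @birkhoff_distortion _ _ _ htheta psi Kp m x (nth s0 (word m x))
        Kp0 psiK (fun i im => esym (nth_word _ im)).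
      by rewrite mulN1r; lra.
    rewrite -sumrN; apply: ler_sum => i _; rewrite ffunE.
    rewrite (Jk _ (iter i left_shift x)); first exact: r_le.
    by move=> j jk; rewrite !iter_left_shift nth_word // addnC -addnS leq_add // ltnW.
rewrite expectD //; last first.
  apply: bounded_measurableD; first exact: bounded_measurable_cst.
  exact: bounded_measurableZ.
rewrite expectD //; [|exact: bounded_measurable_cst|exact: bounded_measurableZ].
rewrite expect_cst expectZ // expect_birkhoff // expect_sum; last by move=> i; exact: bDi.
under eq_bigr do rewrite (expect_iter_left_shift _ muI bD').2.
rewrite expectD; [|exact: bounded_measurable_cst|exact: bounded_measurableZ].
rewrite expect_cst expectZ // expect_indic // sumr_const card_ord /m natrD.
have : M * fine (mu D) <= e / 2.
  apply: (@le_trans _ _ ((M + 1) * fine (mu D))).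
    by rewrite ler_wpM2r ?fine_probability_ge0 // lerDl.
  by rewrite mulrC -ler_pdivlMr.
move=> /(ler_wpM2l (ler0n R n)).
set I := \int[mu]_x _; set F := fine _.
rewrite -[_ *+ n]mulr_natl; lra.
Qed.

Lemma part_entropy_le : part_entropy mu P <= - \int[mu]_x psi x.
Proof.
rewrite /part_entropy; set u := fun n : nat => _.
(* The limit of a divergent sequence is by convention [0]; in that case the bound is just
   [\int psi <= 0]. *)
have [cu|ncu] := pselect (cvgn u); last first.
  rewrite (dvgP ncu) oppr_ge0; exact: psi_le0.
apply/ler_addgt0Pl => e e0; have e2 : 0 < e / 2 by rewrite divr_gt0.
have [C HC] := partition_entropy_n_le e2.
apply: limr_le => //; near=> n.
have n0 : 0 < (n%:R : R) by rewrite ltr0n; near: n; exists 1%N.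
rewrite /u ler_pdivrMr // (le_trans (HC n)) //.
have : C / (e / 2) <= n%:R by near: n; exact: nbhs_infty_ger.
rewrite ler_pdivrMr // => h.
by move: h; set I := \int[mu]_x _; nra.
Unshelve. all: by end_near. Qed.

End EntropyUpperBound.

Lemma ks_entropy_le {R : realType} {S : finType} {s0 : S} {theta : R}
    {mu : probability (shiftA s0) R} {psi : (nat -> S) -> R} :
  0 < theta < 1 -> shift_invariant mu -> theta_lip theta psi ->
  (forall x, \sum_(b : S) expR (psi (scons b x)) = 1) ->
  (ks_entropy mu <= (- \int[mu]_x psi x)%:E)%E.
Proof.
move=> th muI lpsi psi1; apply: ge_ereal_sup => _ [k [P [hP ->]]].
by rewrite lee_fin; exact: (part_entropy_le th muI lpsi psi1 hP).
Qed.

(** * Cylinder masses of the Gibbs measure *)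

Lemma cvgn_sum {R : realType} (I : Type) (r : seq I) (u : I -> R^nat) (l : I -> R) :
  (forall i, u i @ \oo --> l i) ->
  (fun n => \sum_(i <- r) u i n) @ \oo --> \sum_(i <- r) l i.
Proof.
move=> ul; elim: r => [|i r IH].
  by rewrite big_nil; under eq_fun do rewrite big_nil; exact: cvg_cst.
by rewrite big_cons; under eq_fun do rewrite big_cons; exact: cvgD.
Qed.

Section TransferLimit.
Context {R : realType} {S : finType} {theta : R}.
Hypothesis (htheta : 0 < theta < 1).
Context {psi : (nat -> S) -> R} {K : R}.
Hypothesis (psi1 : forall x, \sum_(b : S) expR (psi (scons b x)) = 1).
Hypothesis (K0 : 0 <= K).
Hypothesis (psiK : forall x y, `|psi x - psi y| <= K * dist theta x y).
Implicit Types (f g : (nat -> S) -> R) (x y : nat -> S).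

Local Notation L := (transfer psi).
Local Notation B := (@mixing_bound R theta K).
Local Notation W := (@mixing_potential R theta K).

Let lpsi : theta_lip theta psi. Proof. by exists K. Qed.

Lemma ler_iter_transfer n f g : (forall x, f x <= g x) ->
  forall x, iter n L f x <= iter n L g x.
Proof. by move=> fg; elim: n => //= n IH; exact: ler_transfer. Qed.

Lemma iter_transfer_cst n c : iter n L (fun=> c) = fun=> c.
Proof. by elim: n => //= n ->; apply/funext => x; rewrite transfer_cst. Qed.

Lemma iter_transfer_near n f r (e : R) :
  (forall x, `|f x - r| <= e) -> forall x, `|iter n L f x - r| <= e.
Proof. by move=> fe; elim: n => //= n IH x; exact: transfer_near. Qed.

Lemma iter_transfer_sum (I : Type) (r : seq I) (F : I -> (nat -> S) -> R) n x :
  iter n L (fun y => \sum_(i <- r) F i y) x = \sum_(i <- r) iter n L (F i) x.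
Proof.
elim: n x => //= n IH x.
by rewrite -transfer_sum; congr transfer; apply/funext => y; rewrite IH.
Qed.

(** From [W <= M d] follows [W - d <= (1 - 1 / M) W], so each application of [transfer_mixing] gains
    the factor [1 - 1 / M]. *)
Lemma iter_transfer_contraction f : theta_lip theta f ->
  exists2 k, 0 <= k < 1 & exists2 C, 0 <= C &
  forall n x y, `|iter n L f x - iter n L f y| <= C * k ^+ n.
Proof.
case: (htheta) => /andP[t0 t1] [c c0 fc].
have t1' : 0 < 1 - theta by rewrite subr_gt0.
have B0 := @mixing_bound_gt0 _ _ htheta K.
pose M := (1 - theta)^-1 + K * theta / (1 - theta) * B.
have M1 : 1 <= M.
  apply: (@le_trans _ _ (1 - theta)^-1).
    by rewrite invf_ge1 // gerBl ltW.
  by rewrite lerDl !mulr_ge0 ?invr_ge0 // ltW.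
have M0 : 0 < M by exact: lt_le_trans M1.
exists (1 - M^-1).
  by rewrite subr_ge0 invf_le1 // M1 gtrBl invr_gt0.
have k0 : 0 <= 1 - M^-1 by rewrite subr_ge0 invf_le1.
exists (c * B); first by rewrite mulr_ge0 // ltW.
move=> n x y.
suff h : `|iter n L f x - iter n L f y| <= c * (1 - M^-1) ^+ n * W (dist theta x y).
  rewrite mulrAC; apply: (le_trans h); rewrite ler_wpM2l ?mulr_ge0 ?exprn_ge0 //.
  exact: mixing_potential_le (dist_le1 _ _ _).
elim: n x y => [|n IH] x y /=.
  rewrite expr0 mulr1 (le_trans (fc x y)) // ler_wpM2l //.
  exact: mixing_potential_ge (dist_ge0 _ _ _).
have /le_trans := transfer_mixing htheta psi1 K0 psiK
  (mulr_ge0 c0 (exprn_ge0 n k0)) IH x y; apply.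
rewrite exprSr mulrA -[leRHS]mulrA ler_wpM2l ?mulr_ge0 ?exprn_ge0 //.
have := @mixing_potential_linear _ _ htheta K _ (dist_ge0 htheta x y).
rewrite -/M -ler_pdivrMr // mulrBl mul1r [M^-1 * _]mulrC; lra.
Qed.

(** Later iterates are averages of values of [L^N f], and these values are within [C * k ^+ N] of
    each other; hence the sequence is Cauchy. *)
Lemma cvg_iter_transfer f x : theta_lip theta f -> cvgn (fun n => iter n L f x).
Proof.
move=> lf; have [k k01 [C C0 Lk]] := iter_transfer_contraction lf.
apply: R_complete; apply/cauchyP => e e0.
have : \forall n \near \oo, C * k ^+ n < e.
  have := @cvg_geometric _ C k; rewrite ger0_norm; last by case/andP: k01.
  by case/andP: k01 => _ k1 /(_ k1) /cvgr_lt /(_ _ e0).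
move=> [N _ /(_ N (leqnn N)) /= hN]; exists (iter N L f x).
exists N => // n /= Nn; rewrite /ball /=; apply: le_lt_trans hN.
rewrite distrC -(subnK Nn) iterD; apply: iter_transfer_near => y; exact: Lk.
Qed.

Definition word_cat (w : seq S) (x : nat -> S) : nat -> S := foldr scons x w.

Lemma lipschitz_word_cat w f : theta_lip theta f -> theta_lip theta (f \o word_cat w).
Proof.
elim: w f => [//|b w IH] f lf; exact: IH (lipschitz_scons htheta b lf).
Qed.

Lemma word_cat_nth w x (s0 : S) i : (i < size w)%N -> word_cat w x i = nth s0 w i.
Proof. by elim: w i => [//|b w IH] [//|i] /= iw; exact: IH. Qed.

Lemma iter_shift_word_cat w x : iter (size w) left_shift (word_cat w x) = x.
Proof. by elim: w => [//|b w IH]; rewrite iterSr. Qed.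

(** This is [L^(size w)] applied to the indicator of the cylinder of [w]. It is Lipschitz, and its
    iterates converge to the mass the Gibbs measure gives to the cylinder. *)
Definition cylinder_weight (w : seq S) (x : nat -> S) : R :=
  expR (birkhoff psi (size w) (word_cat w x)).

Local Notation E := cylinder_weight.

Lemma lipschitz_cylinder_weight w : theta_lip theta (E w).
Proof.
apply: lipschitz_expR => //; apply: lipschitz_word_cat.
exact: lipschitz_birkhoff.
Qed.

Lemma sum_cylinder_weight_cons w x : \sum_b E (b :: w) x = E w x.
Proof.
rewrite /E; under eq_bigr do rewrite [birkhoff _ _ _]birkhoff_scons expRD.
by rewrite -mulr_suml psi1 mul1r.
Qed.

Lemma sum_cylinder_weight_rcons w x : \sum_b E (rcons w b) x = L (E w) x.
Proof.
apply: eq_bigr => b _; rewrite /E -expRD addrC size_rcons /birkhoff big_ord_recr /=.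
by rewrite /word_cat foldr_rcons iter_shift_word_cat.
Qed.

Definition gibbs_mass (x0 : nat -> S) (w : seq S) : R :=
  limn (fun n => iter n L (E w) x0).

Context (x0 : nat -> S).
Local Notation p := (gibbs_mass x0).

Lemma gibbs_massP w : (fun n => iter n L (E w) x0) @ \oo --> p w.
Proof.
have /cvg_ex[l ul] := @cvg_iter_transfer _ x0 (lipschitz_cylinder_weight w).
by rewrite /gibbs_mass (cvg_lim _ ul).
Qed.

Lemma gibbs_mass_nil : p [::] = 1.
Proof.
apply: cvg_lim => //; rewrite (_ : (fun n => _) = fun=> 1); first exact: cvg_cst.
apply/funext => n; rewrite (_ : E [::] = fun=> 1) ?iter_transfer_cst //.
by apply/funext => x; rewrite /E birkhoff0 expR0.
Qed.

(** A free symbol in front is what the shift forgets, so this identity becomes shift invariance. *)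
Lemma sum_gibbs_mass_cons w : \sum_b p (b :: w) = p w.
Proof.
have c : (fun n => \sum_b iter n L (E (b :: w)) x0) @ \oo --> \sum_b p (b :: w).
  by apply: cvgn_sum => b; exact: gibbs_massP.
rewrite -(cvg_lim _ c) //; congr (limn _); apply/funext => n.
rewrite -iter_transfer_sum; congr (iter n L _ _); apply/funext => y.
exact: sum_cylinder_weight_cons.
Qed.

(** Kolmogorov consistency. Summing out the last symbol amounts to one more application of [L],
    which only shifts the index of the limit. *)
Lemma sum_gibbs_mass_rcons w : \sum_b p (rcons w b) = p w.
Proof.
have c : (fun n => \sum_b iter n L (E (rcons w b)) x0) @ \oo --> \sum_b p (rcons w b).
  by apply: cvgn_sum => b; exact: gibbs_massP.
rewrite -(cvg_lim _ c) //; apply: cvg_lim => //.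
rewrite (_ : (fun n => _) = fun n => iter n.+1 L (E w) x0).
  by have := @gibbs_massP w; rewrite -(cvg_shiftS _).
apply/funext => n; rewrite -iter_transfer_sum iterSr; congr (iter n L _ _).
by apply/funext => y; exact: sum_cylinder_weight_rcons.
Qed.

(** The Gibbs property: by bounded distortion the weight of [w] lies between two constants, and
    iterates of [L] preserve constant bounds. *)
Lemma gibbs_mass_bounds w y :
  (forall i, (i < size w)%N -> y i = nth (y 0) w i) ->
  expR (birkhoff psi (size w) y - K / (1 - theta)) <= p w /\
  p w <= expR (birkhoff psi (size w) y + K / (1 - theta)).
Proof.
move=> yw; have h x : `|birkhoff psi (size w) (word_cat w x) - birkhoff psi (size w) y|
    <= K / (1 - theta).
  apply: (birkhoff_distortion htheta K0 psiK) => i iw.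
  by rewrite yw // (word_cat_nth _ (y 0)).
split.
  apply: limr_ge; first exact: cvg_iter_transfer (lipschitz_cylinder_weight w).
  near=> n; rewrite -[leLHS]/((fun=> _) x0) -(iter_transfer_cst n).
  apply: ler_iter_transfer => x; rewrite ler_expR.
  by have /ler_normlP[] := h x; lra.
apply: limr_le; first exact: cvg_iter_transfer (lipschitz_cylinder_weight w).
near=> n; rewrite -[leRHS]/((fun=> _) x0) -(iter_transfer_cst n).
apply: ler_iter_transfer => x; rewrite ler_expR.
by have /ler_normlP[] := h x; lra.
Unshelve. all: by end_near. Qed.

End TransferLimit.

(** * Measures with prescribed cylinder masses *)

Section UnitInterval.
Context {R : realType}.

Definition unit_lebesgue : set (measurableTypeR R) -> \bar R :=
  mrestr (@lebesgue_measure R) (measurable_itv `[0%R, 1%R[).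

HB.instance Definition _ := Measure.on unit_lebesgue.

Let unit_lebesgue_setT : unit_lebesgue setT = 1%E.
Proof.
by rewrite /unit_lebesgue /mrestr setTI lebesgue_measure_itv /= lte_fin ltr01 oppr0 adde0.
Qed.

HB.instance Definition _ :=
  Measure_isProbability.Build _ _ _ unit_lebesgue unit_lebesgue_setT.

End UnitInterval.

Section Subdivision.
Context {R : realType} {S : finType} (s0 : S).
Variable a : S -> R.
Hypothesis a0 : forall s, 0 <= a s.

Definition cumul (k : nat) : R := \sum_(j < k) a (nth s0 (enum S) j).
Local Notation rk s := (index s (enum S)).

Let rk_lt s : (rk s < #|S|)%N.
Proof. by rewrite cardE index_mem mem_enum. Qed.

Lemma cumulS s : cumul (rk s).+1 = cumul (rk s) + a s.
Proof. by rewrite /cumul big_ord_recr /= nth_index // mem_enum. Qed.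

Lemma cumul_card : cumul #|S| = \sum_s a s.
Proof.
by rewrite /cumul -(big_mkord xpredT (fun j => a (nth s0 (enum S) j))) cardE
  -(big_nth s0 xpredT) big_enum.
Qed.

Lemma ler_cumul i j : (i <= j)%N -> cumul i <= cumul j.
Proof.
move=> ij; rewrite -(subnKC ij); elim: (j - i)%N => [|k IH]; first by rewrite addn0.
by rewrite addnS (le_trans IH) // /cumul [leRHS]big_ord_recr /= lerDl.
Qed.

Lemma cumul_ge0 i : 0 <= cumul i.
Proof. by apply: sumr_ge0. Qed.

Lemma cumul_le_sum s : cumul (rk s) + a s <= \sum_s a s.
Proof. by rewrite -cumulS -cumul_card ler_cumul // rk_lt. Qed.

Lemma cumul_locate r : 0 <= r < \sum_s a s ->
  exists s, cumul (rk s) <= r < cumul (rk s) + a s.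
Proof.
case/andP=> r0 r1; have h : exists k, r < cumul k by exists #|S|; rewrite cumul_card.
case: (ex_minnP h) => -[|j]; first by rewrite /cumul big_ord0 ltNge r0.
move=> rj jmin; have jS : (j < #|S|)%N.
  by rewrite -ltnS; apply: jmin; rewrite cumul_card.
exists (nth s0 (enum S) j); rewrite -cumulS index_uniq ?enum_uniq -?cardE // rj andbT.
by rewrite leNgt; apply/negP => /jmin; rewrite ltnn.
Qed.

Lemma cumul_unique r s s' : cumul (rk s) <= r < cumul (rk s) + a s ->
  cumul (rk s') <= r < cumul (rk s') + a s' -> s = s'.
Proof.
wlog le : s s' / (rk s <= rk s')%N => [H hs hs'|/andP[_ h] /andP[h' _]].
  by have [/H|/ltnW/H h] := leqP (rk s) (rk s'); [apply|apply/esym/h].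
move: le; rewrite leq_eqVlt => /predU1P[e|lt].
  by rewrite -(nth_index s0 (mem_enum S s)) e nth_index // mem_enum.
by have := ler_cumul lt; rewrite cumulS leNgt (le_lt_trans h' h).
Qed.

End Subdivision.

(* The law with prescribed cylinder masses [p] is the image of Lebesgue measure
   under the map reading off, for [t] in [0, 1), the nested intervals
   containing [t], where the interval of a word [w] has length [p w] and is cut
   into the intervals of the words [rcons w b]. *)
Section CylinderExtension.
Context {R : realType} {S : finType} (s0 : S).
Local Notation T := (shiftA s0).
Variable p : seq S -> R.
Hypothesis p0 : forall w, 0 <= p w.
Hypothesis p_nil : p [::] = 1.
Hypothesis p_rcons : forall w, \sum_b p (rcons w b) = p w.

(* Words are reversed here: the head of [h] is the last symbol read. *)
Local Notation mass h := (p (rev h)).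

Fixpoint left_end (h : seq S) : R :=
  if h is b :: h' then
    left_end h' + cumul s0 (fun s => mass (s :: h')) (index b (enum S))
  else 0.

Definition cell_of (h : seq S) (t : R) := left_end h <= t < left_end h + mass h.

Definition next_symbol (t : R) (h : seq S) : S :=
  odflt s0 [pick s | cell_of (s :: h) t].

Fixpoint history (t : R) (n : nat) : seq S :=
  if n is n'.+1 then next_symbol t (history t n') :: history t n' else [::].

Let sum_mass h : \sum_s mass (s :: h) = mass h.
Proof. by rewrite -p_rcons; apply: eq_bigr => s _; rewrite rev_cons. Qed.

Let cell_ofE s h t : cell_of (s :: h) t =
  (cumul s0 (fun s => mass (s :: h)) (index s (enum S)) <= t - left_end h <
   cumul s0 (fun s => mass (s :: h)) (index s (enum S)) + mass (s :: h)).
Proof. by rewrite /cell_of /= lerBrDl ltrBlDl addrA. Qed.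

Lemma cell_of_child s h t : cell_of (s :: h) t -> cell_of h t.
Proof.
rewrite cell_ofE => /andP[h1 h2]; apply/andP; split.
  by rewrite -subr_ge0 (le_trans _ h1) // cumul_ge0.
rewrite -ltrBlDl (lt_le_trans h2) // -(sum_mass h).
exact: (@cumul_le_sum _ _ s0 (fun s => mass (s :: h)) (fun s => p0 _)).
Qed.

Lemma history_cell t n : 0 <= t < 1 -> cell_of (history t n) t.
Proof.
move=> t01; elim: n => [|n IH] /=.
  by rewrite /cell_of /= add0r /rev /= p_nil.
rewrite /next_symbol; case: pickP => //= none.
have [] := @cumul_locate _ _ s0 (fun s => mass (s :: history t n))
   (t - left_end (history t n)).
  by rewrite sum_mass; case/andP: IH => h1 h2; rewrite subr_ge0 h1 ltrBlDl.
by move=> s; rewrite -cell_ofE none.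
Qed.

Lemma history_eq t h : cell_of h t -> history t (size h) = h.
Proof.
elim: h => [//|s h IH] st /=; rewrite (IH (cell_of_child st)); congr (_ :: _).
rewrite /next_symbol; case: pickP => [s' /=|/(_ s)]; last by rewrite st.
move: st; rewrite !cell_ofE => hs hs'.
exact: (cumul_unique (a := fun s => mass (s :: h)) _ hs' hs).
Qed.

(** With a constant value off [[0, 1)], the preimage of a word contains all of the complement or
    none of it, which keeps preimages measurable. *)
Definition decode (t : measurableTypeR R) : T :=
  if 0 <= t < 1 then fun n => next_symbol t (history t n) else fun=> s0.

Lemma historyE t n : history t n = rev (mkseq (fun n => next_symbol t (history t n)) n).
Proof. by elim: n => [//|n IH]; rewrite mkseqS rev_rcons -IH. Qed.

Lemma word_mkseq n (x : nat -> S) : word n x = mkseq x n :> seq S.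
Proof.
apply: (@eq_from_nth _ s0); rewrite ?size_mkseq ?size_tuple // => i ni.
by rewrite nth_word // nth_mkseq.
Qed.

Lemma decode_word n (w : n.-tuple S) (t : R) : 0 <= t < 1 ->
  word n (decode t) = w <-> left_end (rev w) <= t < left_end (rev w) + p w.
Proof.
move=> t01; rewrite /decode t01 -{3}(revK w); split=> [e|/history_eq].
  rewrite -/(cell_of (rev w) t) -e word_mkseq -historyE.
  exact: history_cell.
rewrite size_rev size_tuple historyE => /(congr1 rev); rewrite !revK -word_mkseq.
exact: val_inj.
Qed.

Lemma decode_preimage n (w : n.-tuple S) :
  decode @^-1` [set x | word n x = w] `&` [set` `[0%R, 1%R[] =
  [set` `[left_end (rev w), left_end (rev w) + p w[] `&` [set` `[0%R, 1%R[].
Proof.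
apply/seteqP; split => t [/= h]; rewrite in_itv /= => t01; split => //.
  by move/(decode_word _ t01): h; rewrite in_itv.
by apply/(decode_word _ t01); rewrite in_itv in h.
Qed.

Lemma measurable_decode_word n (w : n.-tuple S) :
  measurable (decode @^-1` [set x | word n x = w]).
Proof.
rewrite -(setIT (_ @^-1` _)) -(setUv [set` `[0%R, 1%R[]) setIUr decode_preimage.
apply: measurableU; first by apply: measurableI; exact: measurable_itv.
rewrite (_ : _ `&` _ = if `[< word n (fun=> s0) = w >] then ~` [set` `[0%R, 1%R[] else set0).
  by case: ifP => // _; apply: measurableC; exact: measurable_itv.
case: asboolP => h; apply/seteqP; split => t //=; rewrite in_itv /= /decode.
- by case.
- by move=> /negP/negbTE t01; rewrite t01.
- by move=> [+ /negP/negbTE t01]; rewrite t01.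
Qed.

Lemma measurable_decode : measurable_fun setT decode.
Proof.
apply: measurability => // _ [_ [i [s ->]] <-]; rewrite setTI.
rewrite (_ : decode @^-1` _ = \bigcup_(w in [set w : i.+1.-tuple S | nth s0 w i = s])
    decode @^-1` [set x | word i.+1 x = w]).
  by apply: fin_bigcup_measurable => // w _; exact: measurable_decode_word.
apply/seteqP; split=> t /=.
  by move=> ts; exists (word i.+1 (decode t)) => //=; rewrite nth_word.
by move=> [w /= ws /(word_eqP (s0 := s0)) ->].
Qed.

HB.instance Definition _ := isMeasurableFun.Build _ _ _ _ decode measurable_decode.

Lemma left_end_ge0 h : 0 <= left_end h.
Proof. by elim: h => //= s h IH; rewrite addr_ge0 // cumul_ge0. Qed.

Lemma right_end_le1 h : left_end h + mass h <= 1.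
Proof.
elim: h => [|s h IH] /=; first by rewrite add0r /rev /= p_nil.
rewrite -addrA (le_trans _ IH) // lerD2l -(sum_mass h).
exact: (@cumul_le_sum _ _ s0 (fun s => mass (s :: h)) (fun s => p0 _)).
Qed.

Lemma cylinder_extension : exists nu : probability T R,
  forall n (w : n.-tuple S), fine (nu [set x | word n x = w]) = p w.
Proof.
exists (distribution unit_lebesgue decode) => n w.
change (fine (lebesgue_measure (decode @^-1` [set x | word n x = w] `&`
   [set` `[0%R, 1%R[])) = p w).
rewrite decode_preimage.
rewrite setIidl; last first.
  move=> t /=; rewrite !in_itv /= => /andP[h1 h2]; apply/andP; split.
    exact: le_trans (left_end_ge0 _) h1.
  have := right_end_le1 (rev w); rewrite revK; exact: lt_le_trans.
rewrite lebesgue_measure_itv /= lte_fin ltrDl.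
case: ifPn => [_|]; first by rewrite -EFinB /= addrC addKr.
by rewrite -leNgt => h; apply/eqP; rewrite eq_le p0 h.
Qed.

End CylinderExtension.

(** * Entropy of the Gibbs measure *)

Section ShiftInvariance.
Context {R : realType} {S : finType} {s0 : S}.
Local Notation T := (shiftA s0).

Lemma determined_probability (mu : probability T R) k (A : set T) :
  determined k A ->
  fine (mu A) = \sum_(w : k.-tuple S) \1_A (nth s0 w : T) * fine (mu [set x | word k x = w]).
Proof.
move=> Ak; have mA := determined_measurable Ak; rewrite -(expect_indic mA).
rewrite -(expect_code (@measurable_word _ s0 k) (fun w => \1_A (nth s0 w : T))).
apply: eq_Rintegral => x _; rewrite !indicE; congr (_%:R); congr (nat_of_bool _).
apply/idP/idP; rewrite !inE; apply: Ak => i ik; rewrite nth_word //.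
Qed.

(** Sets determined by finitely many coordinates form a generating family stable under intersection,
    so uniqueness of measures applies. *)
Lemma probability_eq_determined (mu nu : probability T R) :
  (forall k (A : set T), determined k A -> mu A = nu A) ->
  forall A, measurable A -> mu A = nu A.
Proof.
move=> munu A mA.
apply: (@g_sigma_algebra_measure_unique _ _ _ [set A | exists k, determined k A] _
   (fun=> setT)) => //.
- by move=> B [k /determined_measurable].
- by move=> i; exists 0.
- by rewrite bigcup_const //; exists 0.
- move=> B C [k Bk] [l Cl]; exists (maxn k l) => x y xy [Bx Cx]; split.
    by apply: Bk Bx => i ik; rewrite xy // leq_max ik.
  by apply: Cl Cx => i ik; rewrite xy // leq_max ik orbT.
- by move=> B [k]; exact: munu.
- by move=> k; rewrite (le_lt_trans (probability_le1 _ _)) // ltry.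
- move: A mA; apply: smallest_sub; first exact: smallest_sigma_algebra.
  move=> _ [i [s ->]]; apply: sub_sigma_algebra.
  by exists i.+1; exact: determined_coord.
Qed.

Lemma shift_invariantP (p : seq S -> R) (mu : probability T R) :
  (forall n (w : n.-tuple S), fine (mu [set x | word n x = w]) = p w) ->
  (forall w, \sum_b p (b :: w) = p w) -> shift_invariant mu.
Proof.
move=> mup p_cons A mA.
pose X : {mfun T >-> T} := HB.pack (@left_shift S : T -> T)
  (isMeasurableFun.Build _ _ _ _ _ measurable_left_shift).
rewrite -[LHS]/(distribution mu X A).
apply: (probability_eq_determined _ mA) => k {mA}A Ak.
have Ak' : determined k.+1 (left_shift @^-1` A : set T).
  by move=> x y xy; apply: Ak => i ik; exact: xy.
have mA := determined_measurable Ak.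
rewrite -[LHS]fineK ?fin_num_measure // -[RHS]fineK ?fin_num_measure //.
congr EFin; rewrite [RHS](determined_probability _ Ak).
transitivity (fine (mu (left_shift @^-1` A : set T))) => //.
rewrite (determined_probability _ Ak').
rewrite big_tuple_cons exchange_big /=; apply: eq_bigr => w _.
rewrite mup -p_cons mulr_sumr; apply: eq_bigr => b _; rewrite mup.
by congr (_ * _).
Qed.

End ShiftInvariance.

(** * Entropy lower bound from the Gibbs property *)

Section EntropyLowerBound.
Context {R : realType} {S : finType} {s0 : S} {theta : R}.
Hypothesis (htheta : 0 < theta < 1).
Local Notation T := (shiftA s0).
Context {psi : (nat -> S) -> R} {C : R} {mu : probability T R}.
Hypothesis lpsi : theta_lip theta psi.
Hypothesis muI : shift_invariant mu.
Hypothesis gibbs : forall n (x : T),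
  let m := fine (mu [set y | word n y = word n x]) in
  expR (birkhoff psi n x - C) <= m <= expR (birkhoff psi n x + C).

Let alphabet_partition (i : 'I_#|S|) : set T := [set x | x 0 = enum_val i].

Let partitionP : is_fin_partition alphabet_partition.
Proof.
split=> [i|]; first exact: measurable_coord.
split=> [i j ij|x]; last by exists (enum_rank (x 0)); rewrite /alphabet_partition /= enum_rankK.
apply/seteqP; split => // x [/= xi xj]; case/eqP: ij; apply: enum_val_inj.
by rewrite -xi -xj.
Qed.

Let C0 : 0 <= C.
Proof.
have /andP[h1 h2] := gibbs 0 (fun=> s0).
by have := le_trans h1 h2; rewrite ler_expR; lra.
Qed.

Let entropy_nE n : part_entropy_n mu alphabet_partition n =
  \int[mu]_x - ln (fine (mu [set y | word n y = word n x])).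
Proof.
pose code (x : T) : {ffun 'I_n -> 'I_#|S|} := [ffun i : 'I_n => enum_rank (x i)].
have codeE x w : code x = w <-> forall i : 'I_n, x i = enum_val (w i).
  split=> [<- i|xw]; first by rewrite ffunE enum_rankK.
  by apply/ffunP => i; rewrite ffunE xw enum_valK.
have mcode w : measurable [set x | code x = w].
  apply: (@determined_measurable _ _ n) => x y xy /= <-.
  by apply/ffunP => i; rewrite !ffunE xy.
rewrite (@eq_Rintegral _ _ _ _ _ (fun x => - ln (fine (mu [set y | code y = code x])))).
  rewrite (expect_code mcode (fun w => - ln (fine (mu [set y | code y = w])))).
  apply: eq_bigr => w _.
  have -> : [set x : T | forall i : 'I_n, alphabet_partition (w i) (iter i left_shift x)]
     = [set x | code x = w].
    apply/seteqP; split=> x /=; rewrite codeE => h i; have := h i;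
      by rewrite /alphabet_partition /= iter_left_shift.
  by rewrite /= mulNr mulrC.
move=> x _; congr (- ln (fine (mu _))); apply/seteqP; split=> y /= h.
  apply/ffunP => i; rewrite !ffunE; congr enum_rank.
  by have := congr1 (fun w : n.-tuple S => tnth w i) h; rewrite !tnth_mktuple.
apply/eq_from_tnth => i; rewrite !tnth_mktuple; apply: enum_rank_inj.
by have := congr1 (fun w : {ffun 'I_n -> 'I_#|S|} => w i) h; rewrite !ffunE.
Qed.

(** The entropy is the mean of minus the logarithm of the mass of the observed word, and the Gibbs
    property identifies this logarithm with the Birkhoff sum up to [C]. *)
Let entropy_n_near n :
  `|part_entropy_n mu alphabet_partition n + n%:R * \int[mu]_x psi x| <= C.
Proof.
have bb : bounded_measurable (birkhoff psi n : T -> R).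
  exact: (lipschitz_bounded_measurable htheta (lipschitz_birkhoff htheta _ lpsi)).
have be : bounded_measurable (fun x : T => - ln (fine (mu [set y | word n y = word n x]))).
  exact: (bounded_measurable_code (@measurable_word _ s0 n)
    (fun w => - ln (fine (mu [set y | word n y = w])))).
have bounds x : - C <= - ln (fine (mu [set y | word n y = word n x])) + birkhoff psi n x <= C.
  have /andP[h1 h2] := gibbs n x.
  have m0 : 0 < fine (mu [set y | word n y = word n x]) by apply: lt_le_trans h1; exact: expR_gt0.
  move: h1 h2; rewrite -(lnK m0) !ler_expR expRK; lra.
rewrite entropy_nE -(expect_birkhoff htheta) // -expectD // ler_norml.
rewrite -[X in X <= _](expect_cst (P := mu)) -[X in _ && (_ <= X)](expect_cst (P := mu)).
by apply/andP; split; apply: ler_expect; try exact: bounded_measurable_cst;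
  try exact: bounded_measurableD; move=> x; case/andP: (bounds x).
Qed.

Lemma ks_entropy_ge : ((- \int[mu]_x psi x)%:E <= ks_entropy mu)%E.
Proof.
suff <- : part_entropy mu alphabet_partition = - \int[mu]_x psi x.
  by apply: ereal_sup_ubound; exists #|S|, alphabet_partition.
apply: cvg_lim => //; apply/cvgrPdist_le => e e0; near=> n.
have n0 : 0 < (n%:R : R) by rewrite ltr0n; near: n; exists 1%N.
have Cn : C / e <= n%:R by near: n; exact: nbhs_infty_ger.
rewrite -normrN opprB opprK.
have -> : part_entropy_n mu alphabet_partition n / n%:R + \int[mu]_x psi x =
  (part_entropy_n mu alphabet_partition n + n%:R * \int[mu]_x psi x) / n%:R.
  by field; rewrite lt0r_neq0.
rewrite normrM normfV (gtr0_norm n0) ler_pdivrMr // (le_trans (entropy_n_near n)) //.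
by rewrite mulrC -ler_pdivrMr.
Unshelve. all: by end_near. Qed.

End EntropyLowerBound.

Lemma exists_gibbs_state {R : realType} {S : finType} (s0 : S) {theta : R}
    {psi : (nat -> S) -> R} : 0 < theta < 1 -> theta_lip theta psi ->
  (forall x, \sum_(b : S) expR (psi (scons b x)) = 1) ->
  exists2 nu : probability (shiftA s0) R, shift_invariant nu &
    ((- \int[nu]_x psi x)%:E <= ks_entropy nu)%E.
Proof.
move=> th lpsi psi1; case: (lpsi) => K K0 psiK.
pose p := @gibbs_mass _ _ psi (fun=> s0).
have p_ge0 w : 0 <= p w.
  have [h _] := gibbs_mass_bounds th psi1 K0 psiK (fun=> s0) (w := w)
    (y := nth s0 w) (fun i iw => set_nth_default _ _ iw).
  exact: le_trans (expR_ge0 _) h.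
have [nu nup] := cylinder_extension s0 p_ge0 (gibbs_mass_nil psi1 _)
  (sum_gibbs_mass_rcons th psi1 K0 psiK _).
have nuI : shift_invariant nu.
  exact: shift_invariantP nup (sum_gibbs_mass_cons th psi1 K0 psiK _).
exists nu => //; apply: (ks_entropy_ge th lpsi nuI (C := K / (1 - theta))) => n x /=.
rewrite nup.
have h i : (i < size (word n x))%N -> x i = nth (x 0) (word n x) i.
  by rewrite size_tuple => ni; rewrite nth_word.
have [] := gibbs_mass_bounds th psi1 K0 psiK (fun=> s0) h.
by rewrite size_tuple => h1 h2; apply/andP.
Qed.

(** * Stationarity of equilibrium states *)

(** Follows from [exp y <= 1 / (1 - y)] and [(1 + y + 2 y^2) (1 - y) = 1 + y^2 (1 - 2 y)]. *)
Lemma expR_le_quadratic {R : realType} (y : R) :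
  y <= 1 / 2 -> expR y <= 1 + y + 2 * y ^+ 2.
Proof.
move=> y2; have h : 0 < 1 - y by lra.
have e1 : 1 - y <= expR (- y) by rewrite expR_ge1Dx.
rewrite -[y in expR y]opprK expRN.
apply: (@le_trans _ _ (1 - y)^-1); first by rewrite lef_pV2 ?posrE ?expR_gt0.
rewrite -[leLHS]mul1r ler_pdivrMr //.
have -> : (1 + y + 2 * y ^+ 2) * (1 - y) = 1 + y ^+ 2 * (1 - 2 * y) by ring.
by rewrite lerDl mulr_ge0 ?sqr_ge0 //; lra.
Qed.

Lemma integral_EFin_bounded {d : measure_display} {T : measurableType d}
    {R : realType} (P : probability T R) (f : T -> R) : bounded_measurable f ->
  (\int[P]_x (f x)%:E)%E = (\int[P]_x f x)%:E.
Proof.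
move=> mf; rewrite /Rintegral fineK //.
exact: integrable_fin_num (bounded_measurable_integrable mf).
Qed.

Section Normalization.
Context {R : realType} {S : finType} {theta : R}.
Hypothesis (htheta : 0 < theta < 1).
Variable chi : (nat -> S) -> R.
Hypothesis lchi : theta_lip theta chi.

Definition log_transfer (x : nat -> S) : R := ln (\sum_b expR (chi (scons b x))).

Lemma sum_expR_gt0 x : 0 < \sum_b expR (chi (scons b x)).
Proof.
rewrite (bigD1 (x 0)) //= ltr_pwDl ?expR_gt0 //.
by apply: sumr_ge0 => b _; exact: expR_ge0.
Qed.

(** The logarithm of a sum of exponentials moves by at most the largest change of the exponents. *)
Lemma lipschitz_log_transfer : theta_lip theta log_transfer.
Proof.
case: lchi => K K0 chiK; exists K => // x y.
have step x' y' : (forall b, chi (scons b x') - chi (scons b y') <= K * dist theta x y) ->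
    log_transfer x' - log_transfer y' <= K * dist theta x y.
  move=> h; rewrite lerBlDr -ler_expR expRD /log_transfer !lnK ?posrE ?sum_expR_gt0 //.
  rewrite mulr_sumr; apply: ler_sum => b _; rewrite -expRD ler_expR -lerBlDr //.
have hb b : `|chi (scons b x) - chi (scons b y)| <= K * dist theta x y.
  rewrite (le_trans (chiK _ _)) // ler_wpM2l // dist_scons // ler_piMl ?dist_ge0 //.
  exact: theta_le1.
rewrite ler_norml lerNl opprB !step // => b; have := hb b; rewrite ler_norml; lra.
Qed.

(** At every preimage of [x] the subtracted term equals [log_transfer x], so the weights are divided
    by their own sum. Under an invariant measure the shift in that term disappears from the
    integral. *)
Definition normalize (x : nat -> S) : R := chi x - log_transfer (left_shift x).

Lemma lipschitz_normalize : theta_lip theta normalize.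
Proof.
apply: (lipschitzB htheta) => //.
exact: (lipschitz_left_shift htheta lipschitz_log_transfer).
Qed.

Lemma sum_expR_normalize x : \sum_b expR (normalize (scons b x)) = 1.
Proof.
rewrite (eq_bigr (fun b => expR (chi (scons b x)) / expR (log_transfer x))) => [|b _].
  rewrite -mulr_suml /log_transfer lnK ?posrE ?sum_expR_gt0 //.
  by rewrite divff // lt0r_neq0 // sum_expR_gt0.
by rewrite -expRB.
Qed.

End Normalization.

Section EquilibriumState.
Context {R : realType} {S : finType} {s0 : S} {theta : R}.
Hypothesis (htheta : 0 < theta < 1).
Local Notation T := (shiftA s0).
Context {psi : (nat -> S) -> R} {mu : probability T R}.
Hypothesis lpsi : theta_lip theta psi.
Hypothesis psi1 : forall x, \sum_(b : S) expR (psi (scons b x)) = 1.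
Hypothesis mu_eq : is_equilibrium_state psi mu.

Let muI : shift_invariant mu. Proof. by case: mu_eq. Qed.

Let lipM f (lf : theta_lip theta f) : bounded_measurable (f : T -> R) :=
  lipschitz_bounded_measurable htheta lf.

(* The equilibrium state has nonnegative free energy for [psi], and by
   [ks_entropy_le] nonpositive free energy for every normalized potential. *)
Lemma equilibrium_maximizes g : theta_lip theta g ->
  (forall x, \sum_(b : S) expR (g (scons b x)) = 1) ->
  \int[mu]_x g x <= \int[mu]_x psi x.
Proof.
move=> lg g1; have [nu nuI nu_ge] := exists_gibbs_state s0 htheta lpsi psi1.
have le_mu := ks_entropy_le htheta muI lg g1.
case: mu_eq => _ /(_ nu nuI).
rewrite !integral_EFin_bounded; [|exact: lipM|exact: lipM] => h.
have : (0%:E <= (- \int[mu]_x g x)%:E + (\int[mu]_x psi x)%:E)%E.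
  apply: (@le_trans _ _ (ks_entropy mu + (\int[mu]_x psi x)%:E)%E).
    apply: le_trans h; rewrite -(addNr (\int[nu]_x psi x)) EFinD.
    exact: leeD.
  exact: leeD.
by rewrite -EFinD lee_fin; lra.
Qed.

(** Maximality tested at the normalization of [psi + t f], with [ln s <= s - 1] and the quadratic
    bound on [expR]; divide by [t] and let [t] tend to 0. Positive [t] gives one inequality, and
    [- f] supplies the other. *)
Let expect_transfer_ge f : theta_lip theta f ->
  \int[mu]_x f x <= \int[mu]_x transfer psi f x.
Proof.
move=> lf; have [M M0 fM] := lipschitz_bounded htheta lf.
have lLf := lipschitz_transfer htheta lpsi lf.
suff key t : 0 < t -> t * M <= 1 / 2 ->
    \int[mu]_x f x <= \int[mu]_x transfer psi f x + 2 * t * M ^+ 2.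
  apply/ler_addgt0Pr => e e0.
  (* The first entry ensures [t * M <= 1 / 2], as the quadratic bound requires; the second makes the
     error at most [e]. *)
  pose t := Num.min (1 / (2 * M)) (e / (2 * M ^+ 2)).
  have t0 : 0 < t by rewrite lt_min !divr_gt0 ?mulr_gt0 ?exprn_gt0.
  have t1 : t <= 1 / (2 * M) by rewrite /t ge_min lexx.
  have t2 : t <= e / (2 * M ^+ 2) by rewrite /t ge_min lexx orbT.
  apply: (le_trans (key t t0 _)).
    rewrite -ler_pdivlMr // (le_trans t1) //.
    by rewrite le_eqVlt; apply/orP; left; apply/eqP; field; rewrite lt0r_neq0.
  rewrite lerD2l (_ : 2 * t * M ^+ 2 = t * (2 * M ^+ 2)); last by ring.
  by rewrite -ler_pdivlMr ?mulr_gt0 ?exprn_gt0.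
move=> t0 tM; pose chi x := psi x + t * f x.
have lchi : theta_lip theta chi by apply: lipschitzD => //; exact: lipschitzZ.
have lh := lipschitz_log_transfer htheta lchi.
have := equilibrium_maximizes (lipschitz_normalize htheta lchi) (sum_expR_normalize chi).
have -> : \int[mu]_x normalize chi x =
    \int[mu]_x psi x + t * \int[mu]_x f x - \int[mu]_x log_transfer chi x.
  rewrite -(expect_left_shift muI (lipM lh)) -expectZ; last exact: lipM.
  rewrite -expectD; [|exact: lipM|exact/bounded_measurableZ/lipM].
  rewrite -mulN1r -expectZ; last exact/bounded_measurable_left_shift/lipM.
  rewrite -expectD; last first.
  - exact/bounded_measurableZ/bounded_measurable_left_shift/lipM.
  - exact: lipM lchi.
  by apply: eq_Rintegral => x _; rewrite mulN1r.
move=> h; have {h} : t * \int[mu]_x f x <= \int[mu]_x log_transfer chi x by lra.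
have hle x : log_transfer chi x <= t * transfer psi f x + 2 * t ^+ 2 * M ^+ 2.
  apply: (@le_trans _ _ ((\sum_b expR (chi (scons b x))) - 1)).
    have := @le_ln1Dx R (\sum_b expR (chi (scons b x)) - 1); rewrite [1 + _]addrC subrK.
    by apply; have := sum_expR_gt0 chi x; lra.
  rewrite lerBlDr -addrA -transferZ -[X in _ + X](transfer_cst psi1 _ x) -transferD.
  rewrite /transfer; apply: ler_sum => b _.
  rewrite /chi expRD; set y := t * f (scons b x).
  have yM : `|y| <= t * M by rewrite normrM gtr0_norm // ler_wpM2l ?(ltW t0).
  have y2 : y ^+ 2 <= t ^+ 2 * M ^+ 2.
    rewrite -exprMn -[leLHS]real_normK ?num_real //.
    by apply: lerXn2r; rewrite ?nnegrE // mulr_ge0 // ltW.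
  have hy : y <= 1 / 2 by rewrite (le_trans (ler_norm _)) // (le_trans yM).
  have := ler_wpM2l (expR_ge0 (psi (scons b x))) (expR_le_quadratic hy).
  move=> /le_trans; apply.
  have := ler_wpM2l (expR_ge0 (psi (scons b x))) y2; lra.
move=> h; have {h} : t * \int[mu]_x f x <= t * \int[mu]_x transfer psi f x + 2 * t ^+ 2 * M ^+ 2.
  apply: (le_trans h); rewrite -expectZ; last exact: lipM.
  rewrite -[X in _ + X](expect_cst (P := mu)) -expectD; last first.
  - exact: bounded_measurable_cst.
  - exact/bounded_measurableZ/lipM.
  apply: ler_expect => //; first exact: lipM.
  by apply: bounded_measurableD; [exact/bounded_measurableZ/lipM|exact: bounded_measurable_cst].
rewrite (_ : _ + 2 * t ^+ 2 * M ^+ 2 = t * (\int[mu]_x transfer psi f x + 2 * t * M ^+ 2)).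
  by rewrite ler_pM2l.
by ring.
Qed.

Lemma expect_transfer f : theta_lip theta f ->
  \int[mu]_x transfer psi f x = \int[mu]_x f x.
Proof.
move=> lf; apply/eqP; rewrite eq_le expect_transfer_ge // andbT.
have lLf := lipschitz_transfer htheta lpsi lf.
have := expect_transfer_ge (lipschitzZ htheta (-1) lf).
rewrite expectZ; last exact: lipM.
rewrite (_ : transfer psi (fun x => -1 * f x) = fun x => -1 * transfer psi f x).
  by rewrite expectZ; [rewrite !mulN1r lerN2|exact: lipM].
by apply/funext => x; rewrite transferZ.
Qed.

End EquilibriumState.

(** * Exponential moments *)

Section Concentration.
Context {R : realType} {S : finType} {s0 : S} {theta : R}.
Hypothesis (htheta : 0 < theta < 1).
Local Notation T := (shiftA s0).
Context {psi : (nat -> S) -> R} {K : R} {mu : probability T R}.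
Hypothesis psi1 : forall x, \sum_(b : S) expR (psi (scons b x)) = 1.
Hypothesis K0 : 0 <= K.
Hypothesis psiK : forall x y, `|psi x - psi y| <= K * dist theta x y.
Hypothesis muL : forall f, theta_lip theta f ->
  \int[mu]_x transfer psi f x = \int[mu]_x f x.
Context {phi : (nat -> S) -> R} {N : R}.
Hypothesis N0 : 0 <= N.
Hypothesis phiN : forall x y, `|phi x - phi y| <= N * dist theta x y.
Hypothesis phi0 : \int[mu]_x phi x = 0.

Local Notation L := (transfer psi).
Local Notation W := (@mixing_potential R theta K).
Local Notation D := (N * @mixing_bound R theta K).

Let lpsi : theta_lip theta psi. Proof. by exists K. Qed.
Let lphi : theta_lip theta phi. Proof. by exists N. Qed.
Let lipM f (lf : theta_lip theta f) : bounded_measurable (f : T -> R) :=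
  lipschitz_bounded_measurable htheta lf.

(* [resolvent_sum k] is the sum of [L^i phi] over [i <= k]. *)
Fixpoint resolvent_sum (k : nat) (x : nat -> S) : R :=
  if k is k'.+1 then phi x + L (resolvent_sum k') x else phi x.
Local Notation H := resolvent_sum.

Lemma lipschitz_resolvent_sum k : theta_lip theta (H k).
Proof.
elim: k => [|k IH] //=; apply: lipschitzD => //.
exact: lipschitz_transfer.
Qed.

(** [N * W] reproduces itself under the recursion: [phi] contributes [N d], and [L] turns [N W] into
    at most [N (W - d)]. Hence the bound is uniform in [k]. *)
Lemma resolvent_sum_mixing k x y : `|H k x - H k y| <= N * W (dist theta x y).
Proof.
elim: k x y => [|k IH] x y /=.
  by rewrite (le_trans (phiN x y)) // ler_wpM2l // mixing_potential_ge // dist_ge0.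
rewrite opprD addrACA (le_trans (ler_normD _ _)) //.
have := phiN x y; have := transfer_mixing htheta psi1 K0 psiK N0 IH x y.
by rewrite mulrBr; lra.
Qed.

Lemma resolvent_sum_osc k x y : `|H k x - H k y| <= D.
Proof.
rewrite (le_trans (resolvent_sum_mixing k x y)) // ler_wpM2l //.
by rewrite mixing_potential_le // dist_le1.
Qed.

Lemma expect_resolvent_sum k : \int[mu]_x H k x = 0.
Proof.
elim: k => [//|k IH] /=; have lH := lipschitz_resolvent_sum k.
rewrite expectD; [|exact: lipM|exact/lipM/lipschitz_transfer].
by rewrite phi0 add0r muL.
Qed.

(** A function of mean zero never exceeds its oscillation; this bounds what is left after all
    coordinates are peeled off. *)
Lemma resolvent_sum_le k x : H k x <= D.
Proof.
have lH := lipschitz_resolvent_sum k.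
have : \int[mu]_y (H k x - D) <= \int[mu]_y H k y.
  apply: ler_expect => [||y]; [exact: bounded_measurable_cst|exact: lipM|].
  have := resolvent_sum_osc k x y; rewrite ler_norml; lra.
by rewrite expect_cst expect_resolvent_sum subr_le0.
Qed.

(** Under the weights at [x], the values [H k (scons b x)] have mean [L (H k) x] and deviate from it
    by at most [D], so the linear term of the exponential averages to zero. *)
Lemma transfer_expR_le k (l : R) x : 0 <= l -> l * D <= 1 / 2 ->
  L (fun y => expR (l * H k y)) x <= expR (l * L (H k) x + 2 * (l * D) ^+ 2).
Proof.
move=> l0 lD; pose r := L (H k) x.
have Hr b : `|H k (scons b x) - r| <= D.
  rewrite distrC; apply: (transfer_near psi1) => y; exact: resolvent_sum_osc.
rewrite -/r expRD.
apply: (@le_trans _ _ (\sum_b expR (psi (scons b x)) * (expR (l * r) *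
   (1 + l * (H k (scons b x) - r) + 2 * (l * D) ^+ 2)))).
  apply: ler_sum => b _; rewrite ler_wpM2l ?expR_ge0 //.
  have -> : l * H k (scons b x) = l * r + l * (H k (scons b x) - r) by ring.
  rewrite expRD ler_wpM2l ?expR_ge0 //; set y := l * (_ - _).
  have yD : `|y| <= l * D by rewrite normrM ger0_norm // ler_wpM2l.
  have y2 : y ^+ 2 <= (l * D) ^+ 2.
    rewrite -[leLHS]real_normK ?num_real //.
    by apply: lerXn2r; rewrite ?nnegrE // (le_trans _ yD).
  have hy : y <= 1 / 2 by rewrite (le_trans (ler_norm _)) // (le_trans yD).
  have := expR_le_quadratic hy; lra.
have -> : \sum_b expR (psi (scons b x)) * (expR (l * r) *
   (1 + l * (H k (scons b x) - r) + 2 * (l * D) ^+ 2)) =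
   expR (l * r) * (1 + 2 * (l * D) ^+ 2).
  rewrite (eq_bigr (fun b => expR (l * r) * l * (expR (psi (scons b x)) * H k (scons b x))
    + expR (l * r) * (1 - l * r + 2 * (l * D) ^+ 2) * expR (psi (scons b x)))); last first.
    by move=> b _; ring.
  rewrite big_split /= -!mulr_sumr psi1 -/(L (H k) x) -/r; ring.
by rewrite ler_wpM2l ?expR_ge0 // expR_ge1Dx.
Qed.

(** Replacing the integrand by its transfer frees the leading term [phi] of the Birkhoff sum, which
    joins [L (H k)] to form [H k.+1]. The index [k] therefore grows while [j] decreases, and the
    induction must hold for all [k]. *)
Lemma mgf_step (l : R) : 0 <= l -> l * D <= 1 / 2 -> forall j k,
  \int[mu]_x expR (l * (H k x + birkhoff phi j (left_shift x)))
  <= expR (l * D + 2 * (l * D) ^+ 2 * j%:R).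
Proof.
move=> l0 lD; elim=> [|j IH] k.
  rewrite -[leRHS](expect_cst (P := mu)); apply: ler_expect.
  - apply: lipM; apply: lipschitz_expR => //; apply: lipschitzZ => //.
    apply: lipschitzD => //; first exact: lipschitz_resolvent_sum.
    exact: (lipschitz_left_shift htheta (lipschitz_birkhoff htheta 0 lphi)).
  - exact: bounded_measurable_cst.
  - move=> x; rewrite birkhoff0 addr0 mulr0 addr0 ler_expR ler_wpM2l //.
    exact: resolvent_sum_le.
have lHk := lipschitz_resolvent_sum k.
have lE : theta_lip theta (fun y => expR (l * H k y)).
  by apply: lipschitz_expR => //; exact: lipschitzZ.
have lB m : theta_lip theta (fun y => expR (l * birkhoff phi m y)).
  by apply: lipschitz_expR => //; apply: lipschitzZ => //; exact: lipschitz_birkhoff.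
have lN : theta_lip theta (fun x => expR (l * (H k.+1 x + birkhoff phi j (left_shift x)))).
  apply: lipschitz_expR => //; apply: lipschitzZ => //.
  apply: lipschitzD => //; first exact: lipschitz_resolvent_sum.
  exact: (lipschitz_left_shift htheta (lipschitz_birkhoff htheta j lphi)).
rewrite (_ : (fun x : T => _) = (fun x : T =>
    expR (l * H k x) * expR (l * birkhoff phi j.+1 (left_shift x)))); last first.
  by apply/funext => x; rewrite mulrDr expRD.
rewrite -muL; last first.
  apply: lipschitzM => //; exact: (lipschitz_left_shift htheta (lB j.+1)).
apply: (@le_trans _ _ (\int[mu]_x (expR (2 * (l * D) ^+ 2) *
    expR (l * (H k.+1 x + birkhoff phi j (left_shift x)))))).
  apply: ler_expect; last 1 first.
  - move=> x; rewrite [leLHS](transferM_shift (fun y => expR (l * H k y))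
      (fun y => expR (l * birkhoff phi j.+1 y))) birkhoffS.
    apply: (@le_trans _ _ (expR (l * L (H k) x + 2 * (l * D) ^+ 2) *
      expR (l * (phi x + birkhoff phi j (left_shift x))))).
      by rewrite ler_wpM2r ?expR_ge0 // transfer_expR_le.
    rewrite -!expRD le_eqVlt; apply/orP; left; apply/eqP.
    by congr expR => /=; ring.
  - apply: lipM; apply: lipschitz_transfer => //; apply: lipschitzM => //.
    exact: (lipschitz_left_shift htheta (lB j.+1)).
  - exact/bounded_measurableZ/lipM.
rewrite expectZ; last exact: lipM.
apply: le_trans (ler_wpM2l (expR_ge0 _) (IH k.+1)) _.
rewrite -expRD ler_expR -natr1; lra.
Qed.

Lemma upper_tail (l u : R) n : 0 <= l -> l * D <= 1 / 2 ->
  fine (mu [set x : T | u <= birkhoff phi n.+1 x]) <=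
  expR (l * D + 2 * (l * D) ^+ 2 * n%:R - l * u).
Proof.
move=> l0 lD; have lS := lipschitz_birkhoff htheta n.+1 lphi.
have lE : theta_lip theta (fun x => expR (l * birkhoff phi n.+1 x)).
  by apply: lipschitz_expR => //; exact: lipschitzZ.
have mA : measurable [set x : T | u <= birkhoff phi n.+1 x].
  rewrite -[X in measurable X]setTI; apply: measurable_fun_le => //.
  exact: (lipM lS).1.
rewrite -expect_indic //.
apply: (@le_trans _ _ (\int[mu]_x (expR (- (l * u)) * expR (l * birkhoff phi n.+1 x)))).
  apply: ler_expect; first exact: bounded_measurable_indic.
    exact/bounded_measurableZ/lipM.
  move=> x; rewrite indicE; case: (boolP (x \in _)) => [/set_mem /= ux|_]; last first.
    by rewrite mulr_ge0 ?expR_ge0.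
  by rewrite -expRD -[leLHS]expR0 ler_expR -mulrN -mulrDr mulr_ge0 // addrC subr_ge0.
rewrite expectZ; last exact: lipM.
rewrite addrC [leRHS]expRD ler_wpM2l ?expR_ge0 //.
(* Since [H 0] is [phi], [k = 0] and [j = n] account for the whole sum of [n.+1] terms. *)
apply: le_trans (mgf_step l0 lD n 0); rewrite le_eqVlt; apply/orP; left; apply/eqP.
by apply: eq_Rintegral => x _; rewrite birkhoffS.
Qed.

End Concentration.

(** * Constants *)

Section Constants.
Context {R : realType} {theta Np eps z0 : R}.
Hypothesis (htheta : 0 < theta < 1) (hNp : 1 <= Np).
Local Notation a := (a_const theta Np).
Hypothesis heps : 0 < eps < Num.min (1 - a) (1 - theta).
Hypothesis hz0 : 1 < z0 < Num.min
  (Num.min (((a + eps / 2) / a) `^ (U_const theta Np eps)) ((theta + eps) / theta))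
  (Num.min ((1 - eps) / theta) (expR 2)).

Let t1' : 0 < 1 - theta. Proof. by case/andP: htheta => _; rewrite subr_gt0. Qed.

Let a_ge : 1 / 2 <= a.
Proof.
case/andP: (htheta) => t0 t1; have N1 := hNp; rewrite /a_const expRN.
have x1 : 1 <= Np / (1 - theta) by rewrite ler_pdivlMr //; lra.
have : (expR (Np / (1 - theta)))^-1 <= 2^-1.
  by rewrite lef_pV2 ?posrE ?expR_gt0 //; have := expR_ge1Dx (Np / (1 - theta)); lra.
lra.
Qed.

Let eps_bounds : [/\ 0 < eps, eps < 1 - a & eps < 1 - theta].
Proof. by case/andP: heps => e0; rewrite lt_min => /andP[]. Qed.

(** Numerator and denominator are both negative, and the denominator is the larger in absolute
    value: its first logarithm is at most [ln (1 - eps)] and [ln (2 * Np)] is positive. *)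
Lemma U_const_le1 : U_const theta Np eps <= 1.
Proof.
case/andP: (htheta) => t0 t1; have N1 := hNp; have [e0 ea et] := eps_bounds.
have X0 : 0 < theta * eps * (1 - eps - theta) by rewrite !mulr_gt0 //; lra.
have X1 : theta * eps * (1 - eps - theta) <= 1 - eps.
  apply: (@le_trans _ _ (1 * (1 - eps - theta))); last by lra.
  by rewrite ler_wpM2r ?mulr_ile1 //; lra.
have l2 : 0 < ln (2 * Np) by rewrite ln_gt0 //; lra.
have l1 : ln (theta * eps * (1 - eps - theta)) <= ln (1 - eps).
  by rewrite ler_ln ?posrE //; lra.
have l3 : ln (1 - eps) <= 0 by rewrite ln_le0 //; lra.
rewrite /U_const ler_ndivrMr ?mul1r; last by lra.
by rewrite (le_trans _ l1) // gerBl ltW.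
Qed.

(** With exponent at most 1 the power is at most [1 + eps / (2 a)], and
    [eps < 1 - a <= 1 / 2 <= a]. *)
Lemma z0_le : z0 <= 3 / 2.
Proof.
have [e0 ea et] := eps_bounds; have a0 : 0 < a by have := a_ge; lra.
case/andP: hz0 => _; rewrite !lt_min => /andP[/andP[h _] _].
have b : (a + eps / 2) / a = 1 + eps / 2 / a by field; rewrite lt0r_neq0.
have b0 : 0 <= eps / 2 / a by rewrite !divr_ge0 // ltW.
have b1 : eps / 2 / a <= 1 / 2 by rewrite ler_pdivrMr //; have := a_ge; lra.
apply: (le_trans (ltW h)).
apply: (@le_trans _ _ (((a + eps / 2) / a) `^ 1)).
  by apply: ler_powR; [rewrite b; lra|exact: U_const_le1].
by rewrite powRr1 b; lra.
Qed.

(** The common factor of the two exponents of the statement, linear in the first and squared in the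
    second. *)
Definition rate : R := (1 - (Num.sqrt z0)^-1) * (1 - a - eps) * ln (Num.sqrt z0).

(** For the last bound, [1 - a] reduces [mixing_bound] to at most [1 / (1 - theta)]; what remains is
    at most [(r - 1) ^+ 2] with [r = Num.sqrt z0], because [ln r <= r - 1]. *)
Lemma rate_bounds : [/\ 1 <= Num.sqrt z0, 0 <= rate, rate <= 1 &
  mixing_bound (theta := theta) (K := Np) * rate * Num.sqrt z0 <= 1].
Proof.
case/andP: (htheta) => t0 t1; have N1 := hNp; have [e0 ea et] := eps_bounds.
have z32 := z0_le; have a12 := a_ge.
case/andP: hz0 => z1; rewrite !lt_min => /andP[_ /andP[zt _]].
have {}zt : theta * z0 <= 1.
  by have := ltW zt; rewrite ler_pdivlMr // mulrC; lra.
rewrite /rate; set r := Num.sqrt z0.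
have rr : r ^+ 2 = z0 by rewrite sqr_sqrtr // ltW // (lt_trans ltr01).
have r0 : 0 <= r by exact: sqrtr_ge0.
have r1 : 1 <= r by rewrite -(@ler_pXn2r _ 2) ?nnegrE // expr1n rr ltW.
have r32 : r <= 3 / 2 by move: rr; rewrite expr2 => rr; nra.
have rp : 0 < r by lra.
have s1 : ln r <= r - 1.
  by have := @le_ln1Dx _ (r - 1); rewrite [1 + _]addrC subrK; apply; lra.
have s0 : 0 <= ln r by exact: ln_ge0.
set q := 1 - r^-1.
have qr : q * r = r - 1 by rewrite /q mulrBl mul1r mulVf ?lt0r_neq0.
have q0 : 0 <= q by rewrite subr_ge0 invf_le1.
have q1 : q <= 1 by rewrite gerBl invr_ge0.
have ae0 : 0 <= 1 - a - eps by lra.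
split => //.
- by rewrite !mulr_ge0.
- have h : q * (1 - a - eps) <= 1 by rewrite mulr_ile1 //; lra.
  by rewrite mulr_ile1 ?mulr_ge0 //; lra.
have Ba : mixing_bound (theta := theta) (K := Np) * (1 - a) <= (1 - theta)^-1.
  rewrite /mixing_bound /a_const subKr mulrAC -expRD ler_piMl ?invr_ge0 ?(ltW t1') //.
  rewrite -[leRHS]expR0 ler_expR.
  have -> : Np * theta / (1 - theta) + - (Np / (1 - theta)) = - Np.
    by field; rewrite lt0r_neq0.
  by rewrite oppr_le0; lra.
have B0 := @mixing_bound_gt0 _ _ htheta Np.
(* Multiplied by [z0], the left side is at most [(r - 1) (r + 1) = z0 - 1], which is at most
   [(1 - theta) z0] since [theta z0 <= 1]. *)
have key : (r - 1) ^+ 2 <= 1 - theta.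
  have h : (r - 1) * z0 <= r + 1 by nra.
  rewrite -(ler_pM2r (lt_trans ltr01 z1)) mulrBl mul1r.
  apply: (@le_trans _ _ ((r - 1) * (r + 1))).
    by rewrite expr2 -mulrA ler_wpM2l //; lra.
  have -> : (r - 1) * (r + 1) = z0 - 1 by rewrite -rr; ring.
  lra.
move: B0 Ba; move: mixing_bound => B B0 Ba.
apply: (@le_trans _ _ (B * (1 - a) * (r - 1) ^+ 2)).
  rewrite -!mulrA ler_wpM2l ?(ltW B0) //.
  have -> : q * ((1 - a - eps) * (ln r * r)) = (1 - a - eps) * ((r - 1) * ln r).
    by rewrite -qr; ring.
  have p1 : 0 <= (r - 1) * ln r by rewrite mulr_ge0 // subr_ge0.
  have p2 : 1 - a - eps <= 1 - a by rewrite gerBl ltW.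
  have p3 : (r - 1) * ln r <= (r - 1) ^+ 2 by rewrite expr2 ler_wpM2l // subr_ge0.
  exact: ler_pM.
apply: (@le_trans _ _ ((1 - theta)^-1 * (1 - theta))).
  by apply: ler_pM => //; rewrite ?mulr_ge0 ?sqr_ge0 ?(ltW B0) //; lra.
by rewrite mulVf ?lt0r_neq0.
Qed.

(** Put [x = u * rate / N]. Then [l D] is at most [x / (36 r)], the constant term of the target, by
    the last part of [rate_bounds]. The linear gain is [x^2 / 36] per step and the quadratic loss at
    most [x^2 / 648], leaving more than the required [x^2 / 72]. *)
Lemma tail_exponent_le (N u : R) n : 1 <= N -> 0 < u -> u <= N ->
  let l := u * rate ^+ 2 / (36 * N ^+ 2) in
  let D := N * mixing_bound (theta := theta) (K := Np) in
  [/\ 0 <= l, l * D <= 1 / 2 &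
  l * D + 2 * (l * D) ^+ 2 * n%:R - l * (u * n.+1%:R) <=
  u * rate / (36 * N * Num.sqrt z0) - u ^+ 2 * n.+1%:R * rate ^+ 2 / (72 * N ^+ 2)].
Proof.
have [r1 c0 c1 Bcr] := rate_bounds => N1 u0 uN l D.
have B0 := @mixing_bound_gt0 _ _ htheta Np; rewrite {}/D {}/l.
set B := mixing_bound in B0 Bcr *; set r := Num.sqrt z0 in r1 Bcr *.
move: c0 c1 Bcr; set c := rate => c0 c1 Bcr.
have Np0 : 0 < N by lra.
have rp : 0 < r by lra.
have Bc0 : 0 <= B * c by rewrite mulr_ge0 // ltW.
have Bc1 : B * c <= r^-1 by rewrite -[r^-1]mul1r ler_pdivlMr.
have ri : r^-1 <= 1 by rewrite invf_le1.
have Nn : N != 0 by rewrite lt0r_neq0.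
have uN0 : 0 <= u / N by rewrite divr_ge0 // ltW.
have uN1 : u / N <= 1 by rewrite ler_pdivrMr // mul1r.
have lDE : u * c ^+ 2 / (36 * N ^+ 2) * (N * B) = u / N * c / 36 * (B * c) by field.
have x0 : 0 <= u / N * c by rewrite mulr_ge0.
have x1 : u / N * c <= 1 by rewrite mulr_ile1.
split.
- by apply: divr_ge0; apply: mulr_ge0; rewrite ?exprn_ge0 // ltW.
- rewrite lDE; have : u / N * c / 36 * (B * c) <= u / N * c / 36 * 1.
    by rewrite ler_wpM2l ?divr_ge0 //; lra.
  lra.
rewrite lDE.
have -> : u * c / (36 * N * r) = u / N * c / 36 * r^-1 by field; rewrite Nn lt0r_neq0.
have -> : u ^+ 2 * n.+1%:R * c ^+ 2 / (72 * N ^+ 2) = (u / N * c) ^+ 2 * n.+1%:R / 72 by field.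
have -> : u * c ^+ 2 / (36 * N ^+ 2) * (u * n.+1%:R) = (u / N * c) ^+ 2 * n.+1%:R / 36 by field.
move: x0 x1; set x := u / N * c => x0 x1.
have h1 : x / 36 * (B * c) <= x / 36 * r^-1 by rewrite ler_wpM2l ?divr_ge0.
have h2 : (x / 36 * (B * c)) ^+ 2 <= (x / 36) ^+ 2.
  rewrite exprMn ler_piMr ?exprn_ge0 ?divr_ge0 // exprn_ile1 //; lra.
have h3 : 2 * (x / 36 * (B * c)) ^+ 2 * n%:R <= 2 * (x / 36) ^+ 2 * n.+1%:R.
  apply: (@le_trans _ _ (2 * (x / 36) ^+ 2 * n%:R)).
    by apply: ler_wpM2r; rewrite ?ler_wpM2l.
  by apply: ler_wpM2l; rewrite ?ler_nat // mulr_ge0 ?exprn_ge0 ?divr_ge0.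
have h4 : 0 <= x ^+ 2 * n.+1%:R by rewrite mulr_ge0 ?exprn_ge0.
have h5 : 2 * (x / 36) ^+ 2 * n.+1%:R = x ^+ 2 * n.+1%:R / 648 by field.
lra.
Qed.

End Constants.

Theorem theorem3 (R : realType) (S : finType) (s0 : S) (theta : R)
  (htheta : 0 < theta < 1)
  (phip : (nat -> S) -> R) (Np : R) (hNp : 1 <= Np)
  (hphip : bounded_lip theta Np phip)
  (hnorm : forall x : nat -> S, \sum_(b : S) expR (phip (scons b x)) = 1)
  (mu : probability (shiftA s0) R) (hmu : is_equilibrium_state phip mu)
  (phi : (nat -> S) -> R) (N : R) (hN : 1 <= N)
  (hphi : bounded_lip theta N phi)
  (hE : (\int[mu]_x (phi x)%:E = 0)%E)
  (eps : R)
  (heps : 0 < eps < Num.min (1 - a_const theta Np) (1 - theta))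
  (z0 : R)
  (hz0 : 1 < z0 < Num.min
           (Num.min (((a_const theta Np + eps / 2) / a_const theta Np)
                       `^ (U_const theta Np eps))
                    ((theta + eps) / theta))
           (Num.min ((1 - eps) / theta) (expR 2)))
  (u : R) (hu : 0 < u) (n : nat) (hn : (0 < n)%N) :
  let a := a_const theta Np in
  let q := 1 - (Num.sqrt z0)^-1 in
  (mu [set x : shiftA s0 | (u <= `| (\sum_(i < n) phi (iter i (@left_shift S) x)) / n%:R |)%R]
  <= ((2 * expR (u * q * (1 - a - eps) * ln (Num.sqrt z0)
                / (36 * N * Num.sqrt z0))
        * expR (- (u ^+ 2 * n%:R * q ^+ 2 * (1 - a - eps) ^+ 2
                   * (ln (Num.sqrt z0)) ^+ 2 / (72 * N ^+ 2))))%R)%:E)%E.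
Proof.
cbv zeta; set a := a_const theta Np; set q := 1 - (Num.sqrt z0)^-1.
case: n hn => [//|n] _.
have N0 : 0 <= N by exact: le_trans ler01 hN.
have Np0 : 0 <= Np by exact: le_trans ler01 hNp.
have [phi_le phi_lip] := hphi; have [_ phip_lip] := hphip.
have lphip := bounded_lip_lipschitz Np0 hphip.
have n0 : 0 < (n.+1%:R : R) by rewrite ltr0n.
(* Averages of [phi] never exceed [N], so for [u > N] the event is empty; otherwise [u <= N] keeps
   [l] small enough. *)
have [Nu|uN] := ltP N u.
  rewrite (_ : [set x | _] = set0) ?measure0 ?lee_fin ?mulr_ge0 ?expR_ge0 //.
  apply/seteqP; split => // x /=; apply/negP; rewrite -ltNge; apply: le_lt_trans Nu.
  rewrite normrM normfV (gtr0_norm n0) ler_pdivrMr // (le_trans (ler_norm_sum _ _ _)) //.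
  apply: (@le_trans _ _ (\sum_(i < n.+1) N)); first by apply: ler_sum.
  by rewrite sumr_const card_ord mulr_natr.
have [l0 lD le_exp] := tail_exponent_le htheta hNp heps hz0 n hN hu uN.
have muL := expect_transfer htheta lphip hnorm hmu.
have phi0 : \int[mu]_(x in setT) phi x = 0 by rewrite /Rintegral hE.
have lphi := bounded_lip_lipschitz N0 hphi.
have mphi0 : \int[mu]_x - phi x = 0.
  rewrite -[RHS](mulr0 (-1)) -phi0 -expectZ.
    by apply: eq_Rintegral => x _; rewrite mulN1r.
  exact: lipschitz_bounded_measurable htheta lphi.
have mphi_lip x y : `|- phi x - - phi y| <= N * dist theta x y.
  by rewrite -opprD normrN.
pose A (f : (nat -> S) -> R) := [set x : shiftA s0 | u * n.+1%:R <= birkhoff f n.+1 x].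
have mA f : theta_lip theta f -> measurable (A f).
  move=> lf; rewrite -[X in measurable X]setTI; apply: measurable_fun_le => //.
  exact: lipschitz_measurable htheta (lipschitz_birkhoff htheta _ lf).
have lmphi : theta_lip theta (fun x => - phi x) by exists N.
(* The same one-sided bound for [phi] and [- phi] accounts for the factor 2. *)
rewrite (_ : [set x | _] = A phi `|` A (fun x => - phi x)); last first.
  apply/seteqP; split => x;
    rewrite /A /= normrM normfV (gtr0_norm n0) ler_pdivlMr // /birkhoff sumrN ler_normr.
    by case/orP; [left|right].
  by case=> ->; rewrite ?orbT.
rewrite -[mu _]fineK ?fin_num_measure //; last by apply: measurableU; exact: mA.
rewrite lee_fin.
have -> : u * q * (1 - a - eps) * ln (Num.sqrt z0) = u * rate (theta := theta)
  (Np := Np) (eps := eps) (z0 := z0) by rewrite /rate -/a -/q; ring.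
have -> : u ^+ 2 * n.+1%:R * q ^+ 2 * (1 - a - eps) ^+ 2 * ln (Num.sqrt z0) ^+ 2 =
  u ^+ 2 * n.+1%:R * (rate (theta := theta) (Np := Np) (eps := eps) (z0 := z0)) ^+ 2.
  by rewrite /rate -/a -/q; ring.
rewrite -mulrA -expRD mulr2n mulrDl mul1r.
apply: (le_trans (fine_probabilityU (mA _ lphi) (mA _ lmphi))).
have tail f (fN : forall x y, `|f x - f y| <= N * dist theta x y) f0 :=
  @upper_tail _ _ _ _ htheta _ _ _ hnorm Np0 phip_lip muL f _ N0 fN f0 _ (u * n.+1%:R) n l0 lD.
apply: lerD.
  by apply: (le_trans (tail _ phi_lip phi0)); rewrite ler_expR.
by apply: (le_trans (tail _ mphi_lip mphi0)); rewrite ler_expR.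
Qed.
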